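(* Let $n\ge2$ be an integer. For $q\in\mathbb Z_{\ge0}$ and $k\in\mathbb Z$, the $L^2(X',dA)$-norm of $\Psi_{q,k}$ is $$\|\Psi_{q,k}\|_{L^2(X',dA)}^2=\begin{cases}\dfrac{4\pi n}{2q+1},&k=0,\\[1em]\dfrac{4\pi n}{2q+2\alpha_k+1}\,\dfrac{\Gamma(\alpha_k+q+\mu_k+1)}{\Gamma(\alpha_k+q-\mu_k+1)},&k\ne0.\end{cases}$$
   Context: Let $n\ge 2$, let $x=re^{i\theta}$ be the affine coordinate on $X'=\mathbb P^1\setminus\{0,\infty\}\cong\mathbb C^*$, and let $dA=\frac{4n^2r^{2n-1}}{(1+r^{2n})^2}dr\wedge d\theta$ be the area form of the conic metric $ds_n^2=\frac{4n^2|x|^{2n-2}}{(1+|x|^{2n})^2}|dx|^2$. For $k\in\mathbb Z$ set $\alpha_k=|k|/n$; for $k\ne0$ set $\mu_k=-\alpha_k$ if $\alpha_k\notin\mathbb Z$, and $\mu_k=\alpha_k$ if $\alpha_k\in\mathbb Z_{>0}$. For $q\in\mathbb Z_{\ge0}$ define $$\Psi_{q,0}(r,\theta)=P_q\left(\frac{1-r^{2n}}{1+r^{2n}}\right),\qquad \Psi_{q,k}(r,\theta)=P_{\alpha_k+q}^{\mu_k}\left(\frac{1-r^{2n}}{1+r^{2n}}\right)e^{ik\theta}\quad(k\ne0).$$ Here, for $-1<t<1$, $P_\nu^\mu(t)=\left(\frac{1+t}{1-t}\right)^{\mu/2}\frac{1}{\Gamma(1-\mu)}\,{}_2F_1\left(-\nu,\nu+1;1-\mu;\frac{1-t}2\right)$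 is the Ferrers function of the first kind (with the regularized hypergeometric function when $1-\mu$ is a nonpositive integer), and $P_q=P_q^0$ is the Legendre polynomial. *)

(* Defs.v *)
From HB Require Import structures.
From mathcomp Require Import all_boot all_order all_algebra.
From mathcomp Require Import all_classical all_reals all_analysis measurable_realfun.
From mathcomp Require Import complex.

Set Implicit Arguments.
Unset Strict Implicit.
Unset Printing Implicit Defensive.

Import Order.TTheory GRing.Theory Num.Theory.
Import numFieldNormedType.Exports.

Local Open Scope classical_set_scope.
Local Open Scope ring_scope.

Section SpecialFunctions.
Context {R : realType}.
Implicit Types a b c x z nu mu t : R.

Definition euler_integral x : R :=
  Rintegral lebesgue_measure `]0, +oo[
    (fun t : R => t `^ (x - 1) * expR (- t)).

(* The real Gamma function, extended to x <= 0 by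
   Gamma(x) = Gamma(x + m) / (x (x + 1) ... (x + m - 1)), where m is the least
   natural number such that 0 < x + m.  At the poles x = 0, -1, -2, ... the
   denominator vanishes, so Gamma x = 0 and hence also (Gamma x)^-1 = 0, which
   is the usual value of the entire function 1/Gamma. *)
Definition Gamma x : R :=
  if 0 < x then euler_integral x
  else let m := (Num.truncn (- x)).+1 in
       euler_integral (x + m%:R) / \prod_(i < m) (x + i%:R).

Definition pochhammer a (s : nat) : R := \prod_(i < s) (a + i%:R).

Definition hyp2F1 a b c z : R :=
  limn (series (fun s : nat =>
    pochhammer a s * pochhammer b s / (pochhammer c s * s`!%:R) * z ^+ s)).

Definition hyp2F1_reg a b c z : R :=
  limn (series (fun s : nat =>
    pochhammer a s * pochhammer b s / (Gamma (c + s%:R) * s`!%:R) * z ^+ s)).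

(* Ferrers function of the first kind P_nu^mu(t), for -1 < t < 1. *)
Definition ferrers nu mu t : R :=
  ((1 + t) / (1 - t)) `^ (mu / 2) *
  (if (1 - mu \is a Num.int) && (1 - mu <= 0)
   then hyp2F1_reg (- nu) (nu + 1) (1 - mu) ((1 - t) / 2)
   else (Gamma (1 - mu))^-1 *
        hyp2F1 (- nu) (nu + 1) (1 - mu) ((1 - t) / 2)).

Definition legendre (q : nat) : R -> R := ferrers q%:R 0.

(* exp(i x) *)
Definition expi x : R[i] := (cos x +i* sin x)%C.

End SpecialFunctions.

(* X' = P^1 \ {0, oo} is described by the polar coordinates x = r e^(i theta):
   (r, theta) |-> r e^(i theta) is a bijection from the following set to C^*. *)
Definition polar_domain {R : realType} : set (R * R) :=
  `]0, +oo[ `*` `[0, 2 * pi[.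

Section AreaMeasure.
Context {R : realType} (n : nat).

Definition area_density (p : R * R) : R :=
  4 * n%:R ^+ 2 * p.1 ^+ (2 * n - 1) / (1 + p.1 ^+ (2 * n)) ^+ 2.

(* The measure on X' given by the area form
   dA = 4 n^2 r^(2n-1) / (1 + r^(2n))^2 dr /\ dtheta. *)
Definition dA (A : set (measurableTypeR R * measurableTypeR R)) : \bar R :=
  (\int[lebesgue_measure \x lebesgue_measure]_(p in A)
     ((area_density \_ polar_domain) p)%:E)%E.

Let density_ge0 (p : R * R) : 0 <= (area_density \_ polar_domain) p.
Proof.
rewrite patchE; case: ifPn => // /set_mem[/= + _].
rewrite in_itv/= andbT => r0; rewrite /area_density divr_ge0//.
- by rewrite !mulr_ge0// exprn_ge0// ltW.
- by rewrite exprn_ge0// addr_ge0// exprn_ge0// ltW.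
Qed.

Let measurable_density :
  measurable_fun [set: measurableTypeR R * measurableTypeR R]
    (fun p => ((area_density \_ polar_domain) p)%:E).
Proof.
apply/measurable_EFinP.
have mD : measurable
    (polar_domain : set (measurableTypeR R * measurableTypeR R)).
  by apply: measurableX; exact: measurable_itv.
apply/(measurable_restrictT _ mD)/measurable_funTS.
rewrite /area_density.
apply: measurable_funM.
  apply: measurable_funM; first exact: measurable_cst.
  by apply: measurable_funX; exact: measurable_fst.
pose h (x : R) : R := ((1 + x ^+ (2 * n)) ^+ 2)^-1.
have mh : measurable_fun [set: R] h.
  apply: continuous_measurable_fun => x.
  apply: cvgV.
    by rewrite expf_neq0// gt_eqF// ltr_wpDr// exprM exprn_ge0// sqr_ge0.
  apply: cvgM; apply: cvgD; [exact: cvg_cst|exact: exprn_continuous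
                            |exact: cvg_cst|exact: exprn_continuous].
exact: (measurableT_comp mh measurable_fst).
Qed.

Let dA0 : dA set0 = 0%E. Proof. by rewrite /dA integral_set0. Qed.

Let dA_ge0 A : (0 <= dA A)%E.
Proof. by apply: integral_ge0 => p _; rewrite lee_fin density_ge0. Qed.

Let dA_sigma_additive : semi_sigma_additive dA.
Proof.
apply: semi_sigma_additive_nng_induced; first exact: measurable_density.
by move=> p; rewrite /= lee_fin density_ge0.
Qed.

HB.instance Definition _ :=
  isMeasure.Build _ _ _ dA dA0 dA_ge0 dA_sigma_additive.

End AreaMeasure.

Definition L2norm {R : realType} (n : nat) (f : R * R -> R[i]) : \bar R :=
  'N[dA n]_2%:E[ (fun p => (ComplexField.Normc.normc (f p))%:E) ].

Section Psi.
Context {R : realType} (n : nat).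

Definition alpha (k : int) : R := `|k|%:~R / n%:R.

Definition mu (k : int) : R :=
  if alpha k \is a Num.int then alpha k else - alpha k.

Definition Psi (q : nat) (k : int) (p : R * R) : R[i] :=
  let t : R := (1 - p.1 ^+ (2 * n)) / (1 + p.1 ^+ (2 * n)) in
  if k == 0 then (legendre q t)%:C%C
  else (ferrers (alpha k + q%:R) (mu k) t)%:C%C * expi (k%:~R * p.2).

End Psi.

(* Main.v *)
Require Import Defs.
From HB Require Import structures.
From mathcomp Require Import all_boot all_order all_algebra.
From mathcomp Require Import all_classical all_reals all_analysis measurable_realfun.
From mathcomp Require Import complex.
From mathcomp Require Import ring.

Set Implicit Arguments.
Unset Strict Implicit.
Unset Printing Implicit Defensive.

Import Order.TTheory GRing.Theory Num.Theory.
Import numFieldNormedType.Exports.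

Local Open Scope classical_set_scope.
Local Open Scope ring_scope.

(** The functions [Psi n q k] depend on the angle only through a phase, so the
    squared norm is a one-dimensional integral.  Put [v = r ^ (2 n)] and
    [z = v / (1 + v)], so that the argument of the Ferrers function is
    [t = 1 - 2 z].  The angular integral and the substitution [r |-> v] give
    [4 pi n] times the integral of the squared radial factor against [dz] over
    [[0, 1]], written as an integral over the half-line in [v]
    ([integral_dA_radial]).

    With [a = |k| / n], the radial factor is in all cases a constant times
    [(z (1 - z)) ^ (a / 2) F(z)] with the same polynomial
    [F(z) = 2F1(-q, 2a + q + 1; 1 + a; z)], called [jacobi_poly a q]
    ([radial_factorE]).  For [a] not an integer, and for [k = 0], this is
    Euler's transformation of the Gauss series ([hyp2F1_euler]), which follows
    from Newton's binomial series ([cvg_binom_series]) and the Pfaff-Saalschuetz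
    sum ([gauss_coef_euler]).  For [a] a positive integer, the regularized
    series is a polynomial whose first [a] terms vanish, and shifting the index
    gives [z ^ a F(z)] up to a constant ([ferrers_nat]).

    It remains to integrate [F ^ 2] against the weight [(z (1 - z)) ^ a]
    ([moment_jacobi_sqr]).  The moments of this weight are beta integrals, hence
    quotients of Gamma values ([beta_intE]; the functional equation of [Gamma] is
    a special case of the same identity).  By the Chu-Vandermonde sum, [F] is
    orthogonal to [(1 - z) ^ m] for [m < q], and its moment against
    [(1 - z) ^ q] is explicit.  Expanding the second factor [F] in powers of
    [1 - z] leaves only its leading coefficient times that moment. *)

(** * Hypergeometric coefficients *)

Section Hypergeometric.
Context {R : realType}.
Implicit Types (A B C a b c : R) (q s i j : nat).

Lemma pochhammer0 a : pochhammer a 0 = 1.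
Proof. by rewrite /pochhammer big_ord0. Qed.

Lemma pochhammerS a s : pochhammer a s.+1 = pochhammer a s * (a + s%:R).
Proof. by rewrite /pochhammer big_ord_recr. Qed.

Lemma pochhammerD a s t :
  pochhammer a (s + t) = pochhammer a s * pochhammer (a + s%:R) t.
Proof.
elim: t => [|t IH]; first by rewrite addn0 pochhammer0 mulr1.
by rewrite addnS !pochhammerS IH natrD -mulrA addrA.
Qed.

Lemma pochhammerSl a s : pochhammer a s.+1 = a * pochhammer (a + 1) s.
Proof. by rewrite -add1n pochhammerD pochhammerS pochhammer0 mul1r addr0. Qed.

Lemma pochhammer_gt0 a s : 0 < a -> 0 < pochhammer a s.
Proof. by move=> a0; apply: prodr_gt0 => i _; rewrite ltr_wpDr. Qed.

Lemma pochhammer_oppn_eq0 q s : (q < s)%N -> pochhammer (- q%:R : R) s = 0.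
Proof.
by move=> qs; rewrite /pochhammer (bigD1 (Ordinal qs))//= addNr mul0r.
Qed.

Lemma pochhammer_oppn q s : (s <= q)%N ->
  pochhammer (- q%:R : R) s = (-1) ^+ s * ((q ^_ s)%:R).
Proof.
elim: s => [|s IH] sq; first by rewrite pochhammer0 ffactn0 mul1r.
rewrite pochhammerS IH 1?ltnW// ffactnSr exprS natrM natrB 1?ltnW//.
by ring.
Qed.

(** The coefficient of [z ^ j] in the Gauss series [2F1(A, B; C; z)]. *)
Definition gauss_coef A B C j : R :=
  pochhammer A j * pochhammer B j / (pochhammer C j * j`!%:R).

(** The coefficient of [z ^ i] in the expansion of [(1 - z) `^ (- d)]. *)
Definition binom_coef (d : R) i : R := pochhammer d i / i`!%:R.

Lemma gauss_coefS A B C j : C + j%:R != 0 ->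
  j.+1%:R * (C + j%:R) * gauss_coef A B C j.+1 =
  (A + j%:R) * (B + j%:R) * gauss_coef A B C j.
Proof.
move=> Cj; rewrite /gauss_coef !pochhammerS factS natrM !invfM.
set x := (pochhammer C j)^-1; set y := (j`!%:R)^-1.
rewrite -[RHS]mulr1 -[X in _ = _ * X](mulfV Cj).
rewrite -[RHS]mulr1 -[X in _ = _ * X](mulfV (_ : j.+1%:R != 0 :> R)) ?pnatr_eq0//.
by ring.
Qed.

Lemma binom_coefS (d : R) i :
  i.+1%:R * binom_coef d i.+1 = (d + i%:R) * binom_coef d i.
Proof.
rewrite /binom_coef pochhammerS factS natrM invfM.
rewrite -[RHS]mulr1 -[X in _ = _ * X](mulfV (_ : i.+1%:R != 0 :> R)) ?pnatr_eq0//.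
by ring.
Qed.

Lemma gauss_coef0 A B C : gauss_coef A B C 0 = 1.
Proof. by rewrite /gauss_coef !pochhammer0 fact0 !mul1r invr1. Qed.

(** Euler's transformation, [2F1(C - A, C - B; C; z)] being the product of
    [(1 - z) ^ (A + B - C)] and [2F1(A, B; C; z)], read on the coefficients;
    this is the Pfaff-Saalschuetz sum. *)
Lemma gauss_coef_euler A B C s : (forall i, C + i%:R != 0) ->
  \sum_(j < s.+1) gauss_coef A B C j * binom_coef (C - A - B) (s - j)%N =
  gauss_coef (C - A) (C - B) C s.
Proof.
move=> C0; set d := C - A - B.
elim: s => [|s IH].
  rewrite big_ord_recr big_ord0 /= !gauss_coef0 /binom_coef pochhammer0.
  by rewrite fact0 add0r !mul1r invr1.
have ne : s.+1%:R * (C + s%:R) != 0 by rewrite mulf_neq0 ?pnatr_eq0.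
apply: (mulfI ne); rewrite gauss_coefS// -IH.
(* Certificate of creative telescoping: the left-hand side satisfies the same
   first-order recurrence in s as the right-hand side, up to differences of
   consecutive values of u. *)
pose u j := j%:R * (C + j%:R - 1) * gauss_coef A B C j *
            binom_coef d (s.+1 - j)%N.
have step (j : 'I_s.+1) : (C - A + s%:R) * (C - B + s%:R) *
      (gauss_coef A B C j * binom_coef d (s - j)%N) =
    s.+1%:R * (C + s%:R) * (gauss_coef A B C j * binom_coef d (s.+1 - j)%N) +
    (u j.+1 - u j).
  have js : (j <= s)%N by rewrite -ltnS.
  rewrite /u subSS subSn// -[j.+1%:R](natr1).
  have e1 : (j%:R + 1) * (C + (j%:R + 1) - 1) * gauss_coef A B C j.+1 =
     (A + j%:R) * (B + j%:R) * gauss_coef A B C j.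
    by rewrite -gauss_coefS// -natr1 addrA addrK.
  rewrite e1.
  have := binom_coefS d (s - j)%N; rewrite -natr1 natrB// /d => e2.
  apply/eqP; rewrite -subr_eq0; apply/eqP.
  transitivity ((C + s%:R + j%:R) * gauss_coef A B C j *
    ((C - A - B + (s%:R - j%:R)) * binom_coef (C - A - B) (s - j) -
     (s%:R - j%:R + 1) * binom_coef (C - A - B) (s - j).+1)).
    by rewrite -[s.+1%:R]natr1; ring.
  by rewrite e2 subrr mulr0.
rewrite big_ord_recr/= subnn mulrDr 2!mulr_sumr.
rewrite [RHS](eq_bigr _ (fun (j : 'I_s.+1) _ => step j)) big_split/=; congr (_ + _).
rewrite -(big_mkord xpredT (fun j => u j.+1 - u j)) telescope_sumr//.
rewrite /u subnn mul0r !mul0r subr0 -[s.+1%:R]natr1.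
by rewrite addrA addrK mulrA.
Qed.

(** Chu-Vandermonde, [2F1(-q, b; c; 1)], with [(-q)_s / s!] written as a signed
    binomial coefficient. *)
Lemma chu_vandermonde_bin q b c : 0 < c ->
  \sum_(s < q.+1) (-1) ^+ s * 'C(q, s)%:R * (pochhammer b s / pochhammer c s) =
  pochhammer (c - b) q / pochhammer c q.
Proof.
elim: q b c => [|q IH] b c c0.
  by rewrite big_ord_recr big_ord0 /= add0r bin0 !pochhammer0 !mul1r.
have c1 : 0 < c + 1 by rewrite ltr_wpDr.
pose t k s := (-1) ^+ s * 'C(q, k)%:R * (pochhammer b s / pochhammer c s) : R.
have -> : \sum_(s < q.+2) (-1) ^+ s * 'C(q.+1, s)%:R *
     (pochhammer b s / pochhammer c s) =
   \sum_(s < q.+1) t s s + \sum_(s < q.+1) t s s.+1.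
  rewrite big_ord_recl [X in _ = X + _]big_ord_recl -addrA.
  congr (_ + _); first by rewrite /t !bin0.
  have -> : \sum_(i < q) t (lift ord0 i) (lift ord0 i) =
      \sum_(i < q.+1) t i.+1 i.+1.
    by rewrite [RHS]big_ord_recr/= {3}/t bin_small// mulr0 mul0r addr0.
  rewrite -big_split/=; apply: eq_bigr => i _.
  by rewrite /t /bump /= add1n binS natrD -mulrDl -mulrDr.
rewrite (IH b c c0).
have -> : \sum_(s < q.+1) t s s.+1 =
    - (b / c) * (pochhammer (c - b) q / pochhammer (c + 1) q).
  have := IH (b + 1) (c + 1) c1; rewrite opprD addrACA subrr addr0 => <-.
  rewrite mulr_sumr; apply: eq_bigr => i _.
  rewrite /t !pochhammerSl exprS invfM; ring.
have cq : c * pochhammer (c + 1) q = pochhammer c q * (c + q%:R).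
  by rewrite -pochhammerSl pochhammerS.
have p1 := pochhammer_gt0 q c1.
have p0 := pochhammer_gt0 q c0.
have cq0 : 0 < c + q%:R by rewrite ltr_wpDr.
rewrite !pochhammerS mulNr mulf_div cq.
rewrite -mulrA; field.
by rewrite !gt_eqF.
Qed.

(** The parameter [d] of the Gauss coefficients is exchanged for [c], as happens
    when the moments of a beta weight are applied to [2F1(-q, b; d; z)]. *)
Lemma chu_vandermonde q b c d : 0 < c -> 0 < d ->
  \sum_(s < q.+1)
    gauss_coef (- q%:R) b d s * (pochhammer d s / pochhammer c s) =
  pochhammer (c - b) q / pochhammer c q.
Proof.
move=> c0 d0; rewrite -chu_vandermonde_bin//; apply: eq_bigr => s _.
have sq : (s <= q)%N by rewrite -ltnS.
rewrite /gauss_coef pochhammer_oppn// -bin_ffact natrM.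
have pd := pochhammer_gt0 s d0; have pc := pochhammer_gt0 s c0.
have f0 : s`!%:R != 0 :> R by rewrite pnatr_eq0 -lt0n fact_gt0.
by field; rewrite f0 !gt_eqF.
Qed.

End Hypergeometric.

(** * Newton's binomial series *)

Section BinomialSeries.
Context {R : realType}.
Implicit Types (d x z : R) (N : nat).

Lemma powRD_gt0 (x r s : R) : 0 < x -> x `^ (r + s) = x `^ r * x `^ s.
Proof. by move=> x0; apply: powRD; rewrite (gt_eqF x0) implybT. Qed.

(** Partial sum, up to degree [N], of the binomial series of
    [(1 - x) `^ (- d)]. *)
Definition binom_poly d N : {poly R} := \sum_(i < N.+1) binom_coef d i *: 'X^i.

Lemma binom_polyE d N x :
  (binom_poly d N).[x] = \sum_(i < N.+1) binom_coef d i * x ^+ i.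
Proof.
by rewrite /binom_poly horner_sum; apply: eq_bigr => i _; rewrite !hornerE.
Qed.

(** Up to a single monomial, the partial sums of the binomial series satisfy
    the differential equation [(1 - x) y' = d y] of [(1 - x) `^ (- d)]. *)
Lemma binom_poly_ode d N x :
  (1 - x) * (binom_poly d N)^`().[x] - d * (binom_poly d N).[x] =
  - ((d + N%:R) * binom_coef d N * x ^+ N).
Proof.
elim: N => [|N IH].
  rewrite /binom_poly big_ord_recr big_ord0 /= add0r derivZ expr0 -polyC1 derivC.
  by rewrite scaler0 horner0 hornerZ hornerC expr0; ring.
have -> : binom_poly d N.+1 = binom_poly d N + binom_coef d N.+1 *: 'X^(N.+1).
  by rewrite /binom_poly big_ord_recr.
rewrite derivD derivZ derivXn/= !hornerD !hornerZ hornerMn !hornerXn.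
rewrite mulrDr [d * (_ + _)]mulrDr opprD addrACA IH -binom_coefS exprS.
by rewrite -mulr_natl; ring.
Qed.

(** Bound on the coefficient of the monomial left over in [binom_poly_ode]: its
    absolute value is nonincreasing in [N] as soon as [a <= N]. *)
Lemma binom_coef_bounded (a : R) : 0 <= a ->
  exists2 m, 0 <= m & \forall N \near \oo,
    `|(- a + N%:R) * binom_coef (- a) N| <= m.
Proof.
move=> a0; have [m am] : exists m : nat, a <= m%:R.
  by exists (Num.bound a); rewrite ltW// archi_boundP.
exists `|(- a + m%:R) * binom_coef (- a) m| => //.
exists m => // N /=; elim: N => [|N IH]; first by rewrite leqn0 => /eqP ->.
rewrite leq_eqVlt => /predU1P[->//|]; rewrite ltnS => mN.
apply: le_trans (IH mN).
rewrite -[in leRHS]binom_coefS; set e := N.+1%:R * _.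
have -> : (- a + N.+1%:R) * binom_coef (- a) N.+1 = (1 - a / N.+1%:R) * e.
  rewrite /e [RHS]mulrA [(1 - _) * _]mulrBl divfK ?pnatr_eq0// mul1r.
  by rewrite [- a + _]addrC.
rewrite normrM ler_piMl//.
have aN : a / N.+1%:R <= 1.
  rewrite ler_pdivrMr ?ltr0n// mul1r (le_trans am)// ler_nat.
  exact: leq_trans mN _.
by rewrite ger0_norm ?subr_ge0// lerBlDr lerDl divr_ge0.
Qed.

(** Mean value theorem for the quotient of [binom_poly (- a) N] by
    [(1 - x) `^ a] on [[0, z]]: by [binom_poly_ode] its derivative is a single
    monomial times a power of [1 - x]. *)
Lemma binom_poly_dist (a z : R) N : 0 <= a -> 0 <= z < 1 ->
  `|(binom_poly (- a) N).[z] - (1 - z) `^ a| <=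
  (1 - z) `^ (- 1) * `|(- a + N%:R) * binom_coef (- a) N| * z ^+ N.
Proof.
move=> a0 /andP[z0 z1].
pose h (x : R) := (binom_poly (- a) N).[x] * (1 - x) `^ (- a).
have [e eE] : exists e, e = (- a + N%:R) * binom_coef (- a) N by eexists.
pose dh (x : R) := - (1 - x) `^ (- a - 1) * e * x ^+ N.
have D (x : R) : x < 1 -> is_derive x 1 h (dh x).
  move=> x1; have x1' : 0 < 1 - x by rewrite subr_gt0.
  pose pw (y : R) : R := y `^ (- a).
  have -> : h = horner (binom_poly (- a) N) * (pw \o (cst 1 - id)).
    by apply/funext.
  have H1 : is_derive (1 - x) 1 pw (- a * (1 - x) `^ (- a - 1)).
    exact: is_derive1_powR.
  have H2 : is_derive x 1 (cst 1 - (@id R)) (-1).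
    by apply: trigger_derive; rewrite sub0r.
  have H3 : is_derive x 1 (pw \o (cst 1 - (@id R)))
      (- a * (1 - x) `^ (- a - 1) * -1).
    exact: is_derive1_comp.
  apply: (trigger_derive (is_deriveM (is_derive_poly (binom_poly (- a) N) x) H3)).
  change ((binom_poly (- a) N).[x] * (- a * (1 - x) `^ (- a - 1) * -1) +
    (1 - x) `^ (- a) * (binom_poly (- a) N)^`().[x] = dh x).
  rewrite /dh.
  have -> : (1 - x) `^ (- a) = (1 - x) `^ (- a - 1) * (1 - x).
    by rewrite -[X in _ = _ * X]powRr1 ?ltW// -powRD_gt0// subrK.
  have ode := binom_poly_ode (- a) N x.
  have {ode} : - (e * x ^+ N) =
      (1 - x) * (binom_poly (- a) N)^`().[x] - - a * (binom_poly (- a) N).[x].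
    by rewrite ode eE.
  move=> ode.
  transitivity ((1 - x) `^ (- a - 1) * - (e * x ^+ N)); last by ring.
  rewrite ode; ring.
have [->|zn0] := eqVneq z 0.
  rewrite subr0 !powR1 binom_polyE big_ord_recl big1 ?addr0; last first.
    by move=> i _; rewrite /bump/= expr0n/= mulr0.
  rewrite /binom_coef pochhammer0 fact0 divr1 expr0 mulr1 subrr normr0.
  by rewrite mul1r mulr_ge0// exprn_ge0.
have zgt0 : 0 < z by rewrite lt_neqAle eq_sym zn0.
have [||c] := @MVT _ h dh 0 z zgt0.
- by move=> x; rewrite in_itv/= => /andP[_ xz]; apply/D/(lt_trans xz).
- apply: derivable_within_continuous => x; rewrite in_itv/= => /andP[_ xz].
  by case: (D x (le_lt_trans xz z1)).
rewrite in_itv/= => /andP[c0 cz].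
have -> : h 0 = 1.
  rewrite /h subr0 powR1 mulr1 binom_polyE big_ord_recl big1 ?addr0; last first.
    by move=> i _; rewrite /bump/= expr0n/= mulr0.
  by rewrite /binom_coef pochhammer0 fact0 divr1 expr0 mulr1.
rewrite subr0 => hE.
have z1' : 0 < 1 - z by rewrite subr_gt0.
have c1' : 0 < 1 - c by rewrite subr_gt0 (lt_trans cz).
have -> : (binom_poly (- a) N).[z] - (1 - z) `^ a = (1 - z) `^ a * (h z - 1).
  by rewrite mulrBr mulr1 /h mulrCA -powRD_gt0// subrr powRr0 mulr1.
rewrite -eE hE /dh !normrM normrN.
rewrite (ger0_norm (powR_ge0 _ _)) (ger0_norm (powR_ge0 _ _)).
rewrite (ger0_norm z0) normrX (ger0_norm (ltW c0)).
have -> : (1 - z) `^ a * ((1 - c) `^ (- a - 1) * `|e| * c ^+ N * z) =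
  ((1 - z) `^ a * (1 - c) `^ (- a - 1)) * `|e| * (c ^+ N * z) by ring.
have le1 : (1 - z) `^ a * (1 - c) `^ (- a - 1) <= (1 - z) `^ (-1).
  have E : -1 = a + (- a - 1) :> R by ring.
  rewrite [X in _ <= _ `^ X]E [leRHS]powRD_gt0// ler_wpM2l ?powR_ge0//.
  rewrite -opprD !powRN lef_pV2 ?posrE ?powR_gt0//.
  by rewrite ge0_ler_powR ?addr_ge0// ?nnegrE ?ltW// ltrD2l ltrN2.
apply: ler_pM => //.
- by rewrite !mulr_ge0 ?powR_ge0.
- by rewrite mulr_ge0// exprn_ge0// ltW.
- by rewrite ler_wpM2r.
- rewrite -[leRHS]mulr1; apply: ler_pM => //.
  + by rewrite exprn_ge0// ltW.
  + by rewrite lerXn2r ?nnegrE ?ltW.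
  + exact: ltW.
Qed.

(** Newton's binomial series. *)
Lemma cvg_binom_series (a z : R) : 0 <= a -> 0 <= z < 1 ->
  series (fun i => binom_coef (- a) i * z ^+ i) @ \oo --> (1 - z) `^ a.
Proof.
move=> a0 z01; have /andP[z0 z1] := z01.
have [m m0 bm] := binom_coef_bounded a0.
rewrite -cvg_shiftS.
have -> : [sequence series (fun i => binom_coef (- a) i * z ^+ i) n.+1]_n =
          (fun N => (binom_poly (- a) N).[z]).
  by apply/funext => N; rewrite /= binom_polyE /series/= big_mkord.
apply/subr_cvg0/norm_cvg0P.
have z1' : 0 < 1 - z by rewrite subr_gt0.
apply: (@squeeze_cvgr _ _ _ _ (cst 0) (geometric ((1 - z) `^ (- 1) * m) z)).
- near=> N; rewrite normr_ge0 (le_trans (binom_poly_dist N a0 z01))//=.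
  rewrite ler_wpM2r ?exprn_ge0// ler_wpM2l ?powR_ge0//.
  by near: N.
- exact: cvg_cst.
- by apply: cvg_geometric; rewrite ger0_norm.
Unshelve. all: by end_near. Qed.

End BinomialSeries.

(** * Euler's transformation *)

Section EulerTransformation.
Context {R : realType}.
Implicit Types (g b : nat -> R) (A B C a z l : R) (q m N : nat).

Lemma cauchy_product_partial g b z N :
  \sum_(s < N) (\sum_(j < s.+1) g j * b (s - j)%N) * z ^+ s =
  \sum_(j < N) g j * z ^+ j * \sum_(i < (N - j)%N) b i * z ^+ i.
Proof.
elim: N => [|N IH]; first by rewrite !big_ord0.
rewrite big_ord_recr/= IH [RHS]big_ord_recr/= subSnn big_ord1 expr0 mulr1.
rewrite [X in _ + X = _]mulrC big_ord_recr/= subnn mulrDr addrA.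
congr (_ + _); last by ring.
rewrite mulr_sumr -big_split/=; apply: eq_bigr => j _.
have jN : (j <= N)%N by exact: ltnW.
rewrite subSn// big_ord_recr/= mulrDr; congr (_ + _).
by rewrite -{1}(subnKC jN) exprD; ring.
Qed.

Lemma cvg_cauchy_product_poly g b z l q : (forall j, (q < j)%N -> g j = 0) ->
  series (fun i => b i * z ^+ i) @ \oo --> l ->
  series (fun s => (\sum_(j < s.+1) g j * b (s - j)%N) * z ^+ s) @ \oo -->
    (\sum_(j < q.+1) g j * z ^+ j) * l.
Proof.
move=> gq bl; rewrite mulr_suml.
apply: (@cvg_trans _ ((fun N => \sum_(j < q.+1) g j * z ^+ j *
   series (fun i => b i * z ^+ i) (N - j)%N) @ \oo)).
  apply: near_eq_cvg; near=> N.
  have qN : (q < N)%N by near: N; exists q.+1.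
  rewrite /series/= [RHS]big_mkord cauchy_product_partial.
  rewrite (big_ord_widen_cond N xpredT (fun j => g j * z ^+ j *
    \sum_(0 <= k < (N - j)%N) b k * z ^+ k))//.
  rewrite big_mkcond/=; apply: eq_bigr => j _.
  rewrite big_mkord; case: ifPn => //; rewrite -leqNgt => qj.
  by rewrite gq// !mul0r.
apply: (@cvg_big _ _ (+%R) 0 xpredT); first exact: add_continuous.
move=> j _; apply: cvgMr.
by rewrite (cvg_centern j (series (fun i => b i * z ^+ i))).
Unshelve. all: by end_near. Qed.

(** The polynomial [2F1(-q, B; C; z)] in the variable [z]. *)
Definition gauss_poly q B C : {poly R} :=
  \poly_(j < q.+1) gauss_coef (- q%:R) B C j.

Lemma gauss_coef_oppn_eq0 q B C j : (q < j)%N -> gauss_coef (- q%:R) B C j = 0.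
Proof. by move=> qj; rewrite /gauss_coef pochhammer_oppn_eq0// !mul0r. Qed.

(** Euler's transformation, when one of the transformed parameters is a
    nonpositive integer. *)
Lemma hyp2F1_euler q B C z : 0 < C -> 0 <= B - q%:R - C -> 0 <= z < 1 ->
  hyp2F1 (C + q%:R) (C - B) C z =
  (1 - z) `^ (B - q%:R - C) * (gauss_poly q B C).[z].
Proof.
move=> C0 a0 z01.
have bl := cvg_binom_series a0 z01.
have := cvg_cauchy_product_poly (@gauss_coef_oppn_eq0 q B C) bl.
rewrite mulrC horner_poly => cl; rewrite /hyp2F1; apply/cvg_lim => //.
rewrite (_ : (fun s => _) = (fun s => (\sum_(j < s.+1)
   gauss_coef (- q%:R) B C j * binom_coef (- (B - q%:R - C)) (s - j)) * z ^+ s))//.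
apply/funext => s; have -> : - (B - q%:R - C) = C - (- q%:R) - B by ring.
rewrite gauss_coef_euler; last by move=> i; rewrite gt_eqF// ltr_wpDr.
by rewrite opprK.
Qed.

Lemma limn_series_eventually0 (u : R ^nat) N : (forall s, (N <= s)%N -> u s = 0) ->
  limn (series u) = \sum_(s < N) u s.
Proof.
move=> u0; apply/cvg_lim => //; apply: cvg_near_cst; exists N => // s /= Ns.
rewrite /series/= big_mkord [RHS](big_ord_widen_cond s xpredT u)// [RHS]big_mkcond/=.
by apply: eq_bigr => i _; case: ifPn => //; rewrite -leqNgt => /u0.
Qed.

End EulerTransformation.

(** * Monomial substitutions on the half-line *)

Section MonomialSubstitution.
Context {R : realType}.
Local Notation leb := (@lebesgue_measure R).

Lemma cvg_integral_itv0 (f : R -> R) (b : R^nat) :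
  continuous f -> (forall x, 0 <= x -> 0 <= f x) ->
  nondecreasing_seq b -> (forall x, exists k, x <= b k) ->
  (\int[leb]_(x in `[0%R, b k]) (f x)%:E @[k --> \oo] -->
   \int[leb]_(x in `[0%R, +oo[) (f x)%:E)%E.
Proof.
move=> cf f0 ndb by_.
have mf := continuous_measurable_fun cf.
have -> : `[0, +oo[%classic = \bigcup_k `[0, b k]%classic :> set R.
  apply/seteqP; split => [x|x [k _]]/=; rewrite !in_itv/= ?andbT.
    by move=> x0; have [k xk] := by_ x; exists k => //=; rewrite in_itv/= x0.
  by case/andP.
apply: ge0_nondecreasing_set_cvg_integral.
- move=> i j ij; rewrite subsetEset; apply: subset_itvl.
  by rewrite bnd_simp ndb.
- by move=> i; exact: measurable_itv.
- move=> i; apply/measurable_EFinP; exact: measurable_funTS.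
- move=> i x /=; rewrite in_itv/= => /andP[x0 _].
  by rewrite lee_fin f0.
Qed.

(** The substitution [x = c * y ^ m] in an integral over the positive half-line,
    obtained from the substitution on the segments [[0, k]] by monotone
    convergence. *)
Lemma ge0_integral_monomial_subst_continuous (c : R) (m : nat) (G : R -> R) :
  0 < c -> (0 < m)%N -> continuous G -> (forall x, 0 <= x -> 0 <= G x) ->
  (\int[leb]_(x in `]0%R, +oo[) (G x)%:E =
   \int[leb]_(x in `]0%R, +oo[) (G (c * x ^+ m) * (c * m%:R * x ^+ m.-1))%:E)%E.
Proof.
move=> c0 m0 cG G0.
pose F (x : R) : R := c * x ^+ m.
pose f (x : R) : R := c * m%:R * x ^+ m.-1.
have F0 : F 0 = 0 by rewrite /F expr0n gtn_eqF// mulr0.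
have Fge0 x : 0 <= x -> 0 <= F x by move=> x0; rewrite mulr_ge0 ?exprn_ge0// ltW.
have dF (x : R) : is_derive x 1 F (f x).
  have -> : F = c \*: (@id R ^+ m) by apply/funext => y; rewrite /F /= exprfctE.
  apply: trigger_derive; rewrite /f /= -mulrA.
  by rewrite /GRing.scale/= mulr1.
have F'E : F^`()%classic = f.
  by apply/funext => x; rewrite derive1E; case: (dF x).
have contF : continuous F.
  by move=> x; apply/differentiable_continuous/derivable1_diffP; case: (dF x).
have contf : continuous f.
  by move=> x; apply: cvgMr; exact: exprn_continuous.
have incF : {in `[0, +oo[ &, {homo F : x y / x < y}}.
  move=> x y; rewrite !in_itv/= !andbT => x0 y0 xy.
  by rewrite /F ltr_pM2l// ltrXn2r ?gtn_eqF ?nnegrE// -lt0n.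
have cH : continuous (fun x => G (F x) * f x).
  move=> x; apply: cvgM; last exact: contf.
  by apply: continuous_comp; [exact: contF|exact: cG].
have H0 x : 0 <= x -> 0 <= G (F x) * f x.
  move=> x0; rewrite mulr_ge0//; first exact/G0/Fge0.
  by rewrite /f !mulr_ge0 ?exprn_ge0// ltW.
have mG := continuous_measurable_fun cG.
have mH := continuous_measurable_fun cH.
rewrite integral_itv_obnd_cbnd; last exact/measurable_EFinP/measurable_funTS.
rewrite integral_itv_obnd_cbnd; last exact/measurable_EFinP/measurable_funTS.
have natR (x : R) : exists k : nat, x <= k%:R.
  exists (Num.bound `|x|); rewrite (le_trans (ler_norm x))// ltW//.
  exact: archi_boundP.
have natF x : exists k : nat, x <= F k%:R.
  have [k xk] := natR (x / c); exists k.+1.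
  rewrite -ler_pdivrMl// mulrC (le_trans xk)// (@le_trans _ _ k.+1%:R) ?ler_nat//.
  by rewrite -natrX ler_nat -{1}(expn1 k.+1) leq_pexp2l.
have L1 : (\int[leb]_(x in `[0%R, F k%:R]) (G x)%:E @[k --> \oo] -->
   \int[leb]_(x in `[0%R, +oo[) (G x)%:E)%E.
  apply: (@cvg_integral_itv0 G (fun k => F k%:R)) => //.
  move=> i j ij; rewrite /F ler_pM2l//.
  by rewrite lerXn2r ?nnegrE// ler_nat.
have L2 : (\int[leb]_(x in `[0%R, k%:R]) (G (F x) * f x)%:E @[k --> \oo] -->
   \int[leb]_(x in `[0%R, +oo[) (G (F x) * f x)%:E)%E.
  apply: (@cvg_integral_itv0 _ (fun k => k%:R)) => //.
  by move=> i j ij; rewrite ler_nat.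
apply: (cvg_unique _ L1); first exact: ereal_hausdorff.
rewrite (_ : (fun k => _) = (fun k : nat =>
  \int[leb]_(x in `[0%R, k%:R]) (G (F x) * f x)%:E)%E) //.
apply/funext => k; rewrite -{1}F0 integration_by_substitution_increasing//.
- by apply: eq_integral => x _; rewrite F'E.
- move=> x y; rewrite !in_itv/= => /andP[x0 _] /andP[y0 _].
  by apply: incF; rewrite in_itv/= ?x0 ?y0.
- by move=> x _; rewrite F'E; exact: contf.
- rewrite F'E; apply/cvg_ex; exists (f 0); apply: cvg_at_right_filter; exact: contf.
- rewrite F'E; apply/cvg_ex; exists (f k%:R); apply: cvg_at_left_filter; exact: contf.
- split.
  + by move=> x _; case: (dF x).
  + by apply: cvg_at_right_filter; exact: contF.
  + by apply: cvg_at_left_filter; exact: contF.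
- exact: continuous_subspaceT.
Qed.

(** Continuity on the closed half-line is expressed by composing with the
    absolute value. *)
Lemma ge0_integral_monomial_subst (c : R) (m : nat) (G : R -> R) :
  0 < c -> (0 < m)%N -> continuous (fun x : R => G `|x|) ->
  (forall x, 0 <= x -> 0 <= G x) ->
  (\int[leb]_(x in `]0%R, +oo[) (G x)%:E =
   \int[leb]_(x in `]0%R, +oo[) (G (c * x ^+ m) * (c * m%:R * x ^+ m.-1))%:E)%E.
Proof.
move=> c0 m0 cG G0.
transitivity (\int[leb]_(x in `]0%R, +oo[) (G `|x|)%:E)%E.
  apply: eq_integral => x; rewrite inE/= in_itv/= andbT => x0.
  by rewrite ger0_norm// ltW.
rewrite (ge0_integral_monomial_subst_continuous c0 m0)//; last first.
  by move=> x _; exact: G0.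
apply: eq_integral => x; rewrite inE/= in_itv/= andbT => x0.
by rewrite ger0_norm// mulr_ge0 ?exprn_ge0// ltW.
Qed.

Lemma continuous_normr_powR (p : R) : 0 <= p ->
  continuous (fun x : R => `|x| `^ p).
Proof.
rewrite le_eqVlt => /predU1P[<-|p0] x.
  rewrite (_ : (fun _ => _) = cst 1); first exact: cst_continuous.
  by apply/funext => y; rewrite powRr0.
have [->|x0] := eqVneq x 0; last first.
  apply: (@continuous_comp _ _ _ (fun y : R => `|y|) (fun y : R => y `^ p)).
    exact: norm_continuous.
  apply/differentiable_continuous/derivable1_diffP/derivable_powR.
  by rewrite in_itv/= andbT normr_gt0.
rewrite /continuous_at normr0 powR0 ?gt_eqF//; apply/cvgr0Pnorm_lt => /= e e0.
have e1 : 0 < e `^ p^-1 by rewrite powR_gt0.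
near=> y; rewrite ger0_norm ?powR_ge0//.
have -> : e = (e `^ p^-1) `^ p by rewrite -powRrM mulVf ?gt_eqF// powRr1 ?ltW.
have ye : `|y| < e `^ p^-1.
  near: y; exists (e `^ p^-1) => //= z.
  by rewrite /ball_/= sub0r normrN.
by rewrite gt0_ltr_powR ?nnegrE ?powR_ge0.
Unshelve. all: by end_near. Qed.

End MonomialSubstitution.

(** * Tonelli's theorem on rectangles, Gamma and beta integrals *)

Section TonelliRectangle.
Local Open Scope ereal_scope.
Context d1 d2 (T1 : measurableType d1) (T2 : measurableType d2) (R : realType).
Variables (m1 : {sigma_finite_measure set T1 -> \bar R}).
Variables (m2 : {sigma_finite_measure set T2 -> \bar R}).
Variables (D1 : set T1) (D2 : set T2).
Hypotheses (mD1 : measurable D1) (mD2 : measurable D2).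
Variable f : T1 * T2 -> \bar R.
Hypotheses (mf : measurable_fun setT f).
Hypothesis f0 : forall z, (D1 `*` D2) z -> 0 <= f z.

Let D : set (T1 * T2) := D1 `*` D2.

Let mfD : measurable_fun setT (f \_ D).
Proof.
apply/(measurable_restrictT f (measurableX mD1 mD2)).
exact: measurable_funTS.
Qed.

Let fD0 z : 0 <= (f \_ D) z.
Proof. by apply: erestrict_ge0 => {}z; exact: f0. Qed.

Lemma tonelli_setX1 :
  \int[m1 \x m2]_(z in D1 `*` D2) f z =
  \int[m1]_(x in D1) \int[m2]_(y in D2) f (x, y).
Proof.
rewrite integral_mkcond fubini_tonelli1// [RHS]integral_mkcond.
apply: eq_integral => x _; rewrite /fubini_F patchE; case: ifPn => xD1.
  rewrite [RHS]integral_mkcond; apply: eq_integral => y _.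
  by rewrite !patchE /D in_setX xD1.
by rewrite integral0_eq// => y _; rewrite patchE /D in_setX (negbTE xD1).
Qed.

Lemma tonelli_setX2 :
  \int[m1 \x m2]_(z in D1 `*` D2) f z =
  \int[m2]_(y in D2) \int[m1]_(x in D1) f (x, y).
Proof.
rewrite integral_mkcond fubini_tonelli2// [RHS]integral_mkcond.
apply: eq_integral => y _; rewrite /fubini_G patchE; case: ifPn => yD2.
  rewrite [RHS]integral_mkcond; apply: eq_integral => x _.
  by rewrite !patchE /D in_setX yD2 andbT.
by rewrite integral0_eq// => x _; rewrite patchE /D in_setX (negbTE yD2) andbF.
Qed.

End TonelliRectangle.

Section GammaBeta.
Context {R : realType}.
Local Notation leb := (@lebesgue_measure R).
Local Open Scope ereal_scope.
Implicit Types (a b s v x : R).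

(** Euler's integral of the second kind, with values in the extended reals. *)
Definition gamma_int a : \bar R :=
  \int[leb]_(t in `]0%R, +oo[) (t `^ (a - 1) * expR (- t))%:E.

(** Euler's integral of the first kind, in its half-line form. *)
Definition beta_int a b : \bar R :=
  \int[leb]_(v in `]0%R, +oo[) (v `^ (b - 1) * (1 + v) `^ (- (a + b)))%:E.

Lemma measurable_gamma_integrand a D :
  measurable_fun D (fun t : R => (t `^ (a - 1) * expR (- t))%:E).
Proof.
apply/measurable_EFinP/measurable_funTS; apply: measurable_funM.
  exact: measurable_powR.
by apply: (measurableT_comp (@measurable_expR R)); exact: oppr_measurable.
Qed.

Lemma gamma_int_ge0 a : 0 <= gamma_int a.
Proof.
by apply: integral_ge0 => t _; rewrite lee_fin mulr_ge0 ?powR_ge0 ?expR_ge0.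
Qed.

Lemma gamma_int_scale a s : (1 <= a)%R -> (0 < s)%R ->
  \int[leb]_(t in `]0%R, +oo[) (t `^ (a - 1) * expR (- (s * t)))%:E =
  (s `^ (- a))%:E * gamma_int a.
Proof.
move=> a1 s0; rewrite /gamma_int.
have a10 : (0 <= a - 1)%R by rewrite subr_ge0.
rewrite [in RHS](@ge0_integral_monomial_subst _ s 1
  (fun t => t `^ (a - 1) * expR (- t)))%R//; last 2 first.
- move=> x; apply: cvgM; first exact: continuous_normr_powR.
  apply: (@continuous_comp _ _ _ (fun y : R => - `|y|)%R); last exact: continuous_expR.
  by apply: cvgN; exact: norm_continuous.
- by move=> x _; rewrite mulr_ge0 ?powR_ge0 ?expR_ge0.
rewrite -ge0_integralZl_EFin ?powR_ge0//; last 2 first.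
- move=> x /=; rewrite in_itv/= andbT => x0.
  by rewrite lee_fin !mulr_ge0 ?powR_ge0 ?expR_ge0 ?exprn_ge0 ?ltW.
- apply/measurable_EFinP/measurable_funTS; apply: measurable_funM; last first.
    by apply: measurable_funM => //; exact: measurable_funX.
  apply: measurable_funM.
    apply: (measurableT_comp (measurable_powR _)).
    by apply: measurable_funM => //; exact: measurable_funX.
  apply: (measurableT_comp (@measurable_expR R)); apply: measurable_funN.
  by apply: measurable_funM => //; exact: measurable_funX.
apply: eq_integral => x; rewrite inE/= in_itv/= andbT => x0.
rewrite -EFinM; congr EFin.
rewrite expr1 expr0 !mulr1 powRM ?ltW//.
have -> : (- a = - (a - 1) - 1)%R by ring.
rewrite (powRD_gt0 (- (a - 1)) (-1) s0) (powRN _ (a - 1)) powR_inv1 ?ltW//.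
by field; rewrite !gt_eqF// powR_gt0.
Qed.

(** In the product of the two Gamma integrals, in variables [s] and [t], put
    [t = s v], exchange the order of integration, and rescale [s] by [1 + v]. *)
Lemma gamma_beta_int a b : (1 <= a)%R -> (1 <= b)%R ->
  gamma_int a * gamma_int b = gamma_int (a + b) * beta_int a b.
Proof.
move=> a1 b1.
have ab1 : (1 <= a + b)%R by rewrite (le_trans a1)// lerDl (le_trans _ b1).
pose K (p : R * R) : R :=
  (p.1 `^ (a + b - 1) * p.2 `^ (b - 1) * expR (- ((1 + p.2) * p.1)))%R.
have K0 p : 0 <= (K p)%:E.
  by rewrite lee_fin !mulr_ge0 ?powR_ge0 ?expR_ge0.
have mK : measurable_fun [set: measurableTypeR R * measurableTypeR R] (EFin \o K).
  apply/measurable_EFinP; apply: measurable_funM.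
    apply: measurable_funM.
      exact: (measurableT_comp (measurable_powR _) measurable_fst).
    exact: (measurableT_comp (measurable_powR _) measurable_snd).
  apply: (measurableT_comp (@measurable_expR R)); apply: measurable_funN.
  apply: measurable_funM; last exact: measurable_fst.
  by apply: measurable_funD => //; exact: measurable_snd.
have m0y : measurable (`]0%R, +oo[ : set (measurableTypeR R)) by [].
transitivity (\int[leb]_(s in `]0%R, +oo[)
    \int[leb]_(v in `]0%R, +oo[) (EFin \o K) (s, v)).
  rewrite {1}/gamma_int -ge0_integralZr//; last 3 first.
  - exact: measurable_gamma_integrand.
  - by move=> t _; rewrite lee_fin mulr_ge0 ?powR_ge0 ?expR_ge0.
  - exact: gamma_int_ge0.
  apply: eq_integral => s; rewrite inE/= in_itv/= andbT => s0.
  transitivity (\int[leb]_(v in `]0%R, +oo[)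
      ((s `^ (a + b - 1) * expR (- s))%:E *
       (v `^ (b - 1) * expR (- (s * v)))%:E)); last first.
    apply: eq_integral => v _; rewrite -EFinM /K/=; congr EFin.
    by rewrite mulrDl mul1r opprD expRD [(v * s)%R]mulrC; ring.
  rewrite ge0_integralZl_EFin//; last 3 first.
  - by move=> t _; rewrite lee_fin mulr_ge0 ?powR_ge0 ?expR_ge0.
  - apply/measurable_EFinP/measurable_funTS; apply: measurable_funM.
      exact: measurable_powR.
    apply: (measurableT_comp (@measurable_expR R)); apply: measurable_funN.
    exact: measurable_funM.
  - by rewrite mulr_ge0 ?powR_ge0 ?expR_ge0.
  rewrite gamma_int_scale// muleA -EFinM; congr (_%:E * _).
  have -> : (a + b - 1 = (a - 1) + b)%R by ring.
  rewrite (powRD_gt0 (a - 1) b s0) powRN; field.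
  by rewrite gt_eqF// powR_gt0.
have KD z : (`]0%R, +oo[ `*` `]0%R, +oo[) z -> 0 <= (EFin \o K) z.
  by move=> _; exact: K0.
rewrite -(tonelli_setX1 leb leb m0y m0y mK KD).
rewrite (tonelli_setX2 leb leb m0y m0y mK KD).
rewrite /beta_int -ge0_integralZl//; last 3 first.
- apply/measurable_EFinP/measurable_funTS; apply: measurable_funM.
    exact: measurable_powR.
  by apply: (measurableT_comp (measurable_powR _)); exact: measurable_funD.
- by move=> t _; rewrite lee_fin mulr_ge0 ?powR_ge0.
- exact: gamma_int_ge0.
apply: eq_integral => v; rewrite inE/= in_itv/= andbT => v0.
have v1 : (0 < 1 + v)%R by rewrite ltr_wpDl.
transitivity ((v `^ (b - 1))%:E * ((1 + v) `^ (- (a + b)))%:E *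
    gamma_int (a + b)); last first.
  by rewrite -EFinM muleC.
rewrite -muleA -(gamma_int_scale ab1 v1).
rewrite -ge0_integralZl_EFin//; last 3 first.
- by move=> t _; rewrite lee_fin mulr_ge0 ?powR_ge0 ?expR_ge0.
- apply/measurable_EFinP/measurable_funTS; apply: measurable_funM.
    exact: measurable_powR.
  apply: (measurableT_comp (@measurable_expR R)); apply: measurable_funN.
  exact: measurable_funM.
- by rewrite powR_ge0.
apply: eq_integral => s _; rewrite /K/= -EFinM; congr EFin.
by ring.
Qed.

Lemma gamma_int1 : gamma_int 1 = 1.
Proof.
rewrite /gamma_int integral_itv_obnd_cbnd; last exact: measurable_gamma_integrand.
rewrite -(@integral_exponential_pdf R 1)// integral_mkcond.
apply: eq_integral => x _; rewrite /exponential_pdf !patchE.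
by case: ifPn => // _; rewrite subrr powRr0 !mul1r mulN1r.
Qed.

Local Close Scope ereal_scope.

Lemma cvgy_powRN a : 0 < a -> (1 + v) `^ (- a) @[v --> +oo] --> 0.
Proof.
move=> a0; apply/cvgr0Pnorm_lt => /= e e0.
have p0 : 0 <= e^-1 `^ a^-1 by exact: powR_ge0.
near=> v.
have ve : e^-1 `^ a^-1 < 1 + v.
  by rewrite -ltrBlDl; near: v; apply: nbhs_pinfty_gt; rewrite num_real.
have v1 : 0 < 1 + v by exact: le_lt_trans ve.
rewrite ger0_norm ?powR_ge0// powRN -[ltRHS]invrK ltf_pV2 ?posrE ?invr_gt0 ?powR_gt0//.
have <- : (e^-1 `^ a^-1) `^ a = e^-1.
  by rewrite -powRrM mulVf ?gt_eqF// powRr1// ltW// invr_gt0.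
by rewrite gt0_ltr_powR ?nnegrE// ltW.
Unshelve. all: by end_near. Qed.

Lemma beta_int1 a : (0 < a) -> beta_int a 1 = (a^-1)%:E.
Proof.
move=> a0; rewrite /beta_int.
pose f (v : R) : R := ((1 + v) `^ (- (a + 1))).
pose F (v : R) : R := (- a^-1 * (1 + v) `^ (- a)).
have mf : measurable_fun setT f.
  by apply: (measurableT_comp (measurable_powR _)); exact: measurable_funD.
have dF (v : R) : (0 <= v) -> is_derive v 1 F (f v).
  move=> v0; have v1 : (0 < 1 + v) by rewrite ltr_pwDl.
  pose pw (y : R) : R := (y `^ (- a)).
  have H1 : is_derive (1 + v) 1 pw (- a * (1 + v) `^ (- a - 1)).
    exact: is_derive1_powR.
  have H2 : is_derive v 1 (cst 1 + (@id R)) 1.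
    by apply: trigger_derive; rewrite add0r.
  have H3 : is_derive v 1 (pw \o (cst 1 + (@id R)))
      (- a * (1 + v) `^ (- a - 1) * 1).
    exact: is_derive1_comp.
  have -> : F = (- a^-1) \*: (pw \o (cst 1 + (@id R))) by apply/funext.
  apply: (trigger_derive (is_deriveZ (- a^-1) H3)).
  rewrite /GRing.scale/= /f opprD mulr1 mulrA mulrNN mulVf ?mul1r//.
  by rewrite gt_eqF.
have cF v : (0 <= v) -> {for v, continuous F}.
  move=> v0; apply/differentiable_continuous/derivable1_diffP.
  by case: (dF v v0).
transitivity (\int[leb]_(v in `[0%R, +oo[) (f v)%:E)%E.
  rewrite -integral_itv_obnd_cbnd; last exact/measurable_EFinP/measurable_funTS.
  by apply: eq_integral => v _; rewrite subrr powRr0 mul1r.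
rewrite (@ge0_continuous_FTC2y _ f F 0 0)//.
- by rewrite /F addr0 powR1 mulr1 EFinN oppeK add0e.
- by move=> x _; exact: powR_ge0.
- apply: continuous_in_subspaceT => v; rewrite inE/= in_itv/= andbT => v0.
  have v1 : (0 < 1 + v) by rewrite ltr_pwDl.
  apply: (@continuous_comp _ _ _ (fun v : R => 1 + v) (fun y : R => y `^ (- (a + 1)))).
    by apply: cvgD; [exact: cvg_cst|exact: cvg_id].
  apply/differentiable_continuous/derivable1_diffP/derivable_powR.
  by rewrite in_itv/= andbT.
- by rewrite -(mulr0 (- a^-1)); apply: cvgMr; exact: cvgy_powRN.
- by move=> x x0; case: (dF x (ltW x0)).
- by apply: cvg_at_right_filter; exact: cF.
- move=> x; rewrite in_itv/= andbT => x0; rewrite derive1E.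
  by case: (dF x (ltW x0)).
Qed.

Local Open Scope ereal_scope.

(** The case [b = 1] of [gamma_beta_int]. *)
Lemma gamma_intS a : (1 <= a)%R -> gamma_int (a + 1) = a%:E * gamma_int a.
Proof.
move=> a1; have a0 : (0 < a)%R by rewrite (lt_le_trans _ a1).
have := gamma_beta_int a1 (lexx 1%R); rewrite gamma_int1 beta_int1// mule1 => ->.
by rewrite muleCA -EFinM mulfV ?gt_eqF// mule1.
Qed.

Lemma gamma_int_nat m : gamma_int m.+1%:R = (m`!%:R)%:E.
Proof.
elim: m => [|m IH]; first by rewrite gamma_int1 fact0.
by rewrite -natr1 gamma_intS ?ler1n// IH -EFinM factS natrM.
Qed.

Lemma powR_le_oneD (t : R) (p r : R) : (0 < t)%R -> (0 <= p)%R -> (p <= r)%R ->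
  (t `^ p <= 1 + t `^ r)%R.
Proof.
move=> t0 p0 pr; have [t1|/ltW t1] := leP t 1%R.
  have : (t `^ p <= 1)%R by rewrite -[leRHS](powRr0 t) ger_powR ?t0.
  by move/le_trans; apply; rewrite lerDl powR_ge0.
by apply: (le_trans (ler_powR t1 pr)); rewrite lerDr.
Qed.

(** Comparison with the values at positive integers, which are finite. *)
Lemma gamma_int_lty a : (1 <= a)%R -> gamma_int a < +oo.
Proof.
move=> a1; pose m := Num.bound a.
have am : (a - 1 <= m%:R)%R.
  have := archi_boundP (le_trans ler01 a1); rewrite -/m => am.
  by rewrite lerBlDr (le_trans (ltW am))// lerDl.
apply: (@le_lt_trans _ _ (gamma_int 1 + gamma_int m.+1%:R)); last first.
  by rewrite gamma_int1 gamma_int_nat -EFinD ltry.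
rewrite /gamma_int -ge0_integralD//; last 4 first.
- by move=> t _; rewrite lee_fin mulr_ge0 ?powR_ge0 ?expR_ge0.
- exact: measurable_gamma_integrand.
- by move=> t _; rewrite lee_fin mulr_ge0 ?powR_ge0 ?expR_ge0.
- exact: measurable_gamma_integrand.
apply: ge0_le_integral => //.
- by move=> t _; rewrite lee_fin mulr_ge0 ?powR_ge0 ?expR_ge0.
- exact: measurable_gamma_integrand.
- apply: emeasurable_funD; exact: measurable_gamma_integrand.
move=> t /=; rewrite in_itv/= andbT => t0.
rewrite -EFinD lee_fin -mulrDl ler_wpM2r ?expR_ge0//.
rewrite subrr powRr0 -natr1 addrK.
by apply: powR_le_oneD; rewrite ?subr_ge0.
Qed.

Lemma gamma_int_gt0 a : (1 <= a)%R -> 0 < gamma_int a.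
Proof.
move=> a1.
apply: (@lt_le_trans _ _ (expR (- 2))%:E); first by rewrite lte_fin expR_gt0.
have -> : (expR (- 2))%:E = \int[leb]_(t in `[1%R, 2%R]) (expR (- 2))%:E.
  rewrite integral_cst//= lebesgue_measure_itv/= lte_fin ltr1n -EFinB.
  by rewrite -EFinM; congr EFin; rewrite -[LHS]mulr1; congr (_ * _)%R; ring.
apply: (@le_trans _ _ (\int[leb]_(t in `[1%R, 2%R]) (t `^ (a - 1) * expR (- t))%:E)).
  apply: ge0_le_integral => //; first exact: measurable_gamma_integrand.
  move=> t /=; rewrite in_itv/= => /andP[t1 t2]; rewrite lee_fin.
  rewrite -[leLHS]mul1r ler_pM ?expR_ge0//; last by rewrite ler_expR lerN2.
  by rewrite -[leLHS](@powRr0 R t) ler_powR// subr_ge0.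
apply: ge0_subset_integral => //.
- exact: measurable_gamma_integrand.
- by move=> t _; rewrite lee_fin mulr_ge0 ?powR_ge0 ?expR_ge0.
- move=> t /=; rewrite !in_itv/= andbT => /andP[t1 _].
  by rewrite (lt_le_trans _ t1).
Qed.

Lemma EFin_Gamma a : (1 <= a)%R -> (Gamma a)%:E = gamma_int a.
Proof.
move=> a1; rewrite /Gamma (lt_le_trans _ a1)// /euler_integral /Rintegral.
by rewrite fineK// ge0_fin_numE ?gamma_int_lty// gamma_int_ge0.
Qed.

Local Close Scope ereal_scope.

Lemma Gamma_gt0 a : 1 <= a -> 0 < Gamma a.
Proof. by move=> a1; rewrite -lte_fin EFin_Gamma// gamma_int_gt0. Qed.

Lemma GammaS a : 1 <= a -> Gamma (a + 1) = a * Gamma a.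
Proof.
move=> a1; apply: EFin_inj; rewrite EFinM !EFin_Gamma ?gamma_intS//.
by rewrite (le_trans a1)// lerDl.
Qed.

Lemma Gamma_pochhammer a j : 1 <= a -> Gamma (a + j%:R) = Gamma a * pochhammer a j.
Proof.
move=> a1; elim: j => [|j IH]; first by rewrite addr0 pochhammer0 mulr1.
rewrite -natr1 addrA GammaS ?(le_trans a1) ?lerDl// IH pochhammerS.
by rewrite mulrCA [X in _ * X]mulrC.
Qed.

Lemma Gamma_natS m : Gamma (m.+1%:R) = m`!%:R :> R.
Proof. by apply: EFin_inj; rewrite EFin_Gamma ?gamma_int_nat// ler1n. Qed.

(** [Gamma] takes the default value [0] at its poles, so that its inverse is
    there the value of the entire function [1 / Gamma]. *)
Lemma Gamma_oppn m : Gamma (- m%:R) = 0 :> R.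
Proof.
rewrite /Gamma ltrNr oppr0 ltrn0 opprK natrK.
by rewrite (bigD1 ord_max)//= addNr mul0r invr0 mulr0.
Qed.

(** The half-line beta integral is a quotient of Gamma values. *)
Lemma beta_intE a b : 1 <= a -> 1 <= b ->
  beta_int a b = (Gamma a * Gamma b / Gamma (a + b))%:E.
Proof.
move=> a1 b1; have ab1 : 1 <= a + b by rewrite (le_trans a1)// lerDl (le_trans _ b1).
have := gamma_beta_int a1 b1; rewrite -!EFin_Gamma// -EFinM => E.
have G0 := Gamma_gt0 ab1.
by rewrite EFinM E muleAC -EFinM mulfV ?mul1e// gt_eqF.
Qed.

End GammaBeta.

(** * Ferrers functions as Jacobi polynomials *)

Section FerrersValues.
Context {R : realType}.
Implicit Types (a z : R) (q m j : nat).

(** The polynomial [2F1(-q, 2a + q + 1; 1 + a; z)], a Jacobi polynomial of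
    parameters [(a, a)] in the variable [1 - 2z], up to normalization. *)
Definition jacobi_poly a q : {poly R} := gauss_poly q (2 * a + q%:R + 1) (1 + a).

Lemma powR_div (y z r : R) : 0 < y -> 0 < z -> (y / z) `^ r = y `^ r * z `^ (- r).
Proof.
move=> y0 z0; rewrite powRM ?invr_ge0 ?ltW//; congr (_ * _).
by rewrite -powR_inv1 ?ltW// -powRrM mulN1r.
Qed.

(** In terms of [z], with [t = 1 - 2 z], these are the argument of the
    hypergeometric series and the base of the prefactor of [ferrers]. *)
Lemma ferrers_arg z :
  ((1 - (1 - 2 * z)) / 2 = z) * ((1 + (1 - 2 * z)) / (1 - (1 - 2 * z)) = (1 - z) / z).
Proof.
have -> : 1 - (1 - 2 * z) = 2 * z by ring.
have -> : 1 + (1 - 2 * z) = 2 * (1 - z) by ring.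
split; first by rewrite mulrC mulKf.
by rewrite invfM mulrACA mulfV// mul1r.
Qed.

(** Euler's transformation turns the Gauss series of the Ferrers function of
    degree [a + q] and order [- a] into the polynomial [jacobi_poly a q].  The case [a = 0] covers the
    Legendre polynomials. *)
Lemma ferrers_oppr a q z : 0 <= a -> 0 < z < 1 ->
  ferrers (a + q%:R) (- a) (1 - 2 * z) =
  (Gamma (1 + a))^-1 * ((z * (1 - z)) `^ (a / 2) * (jacobi_poly a q).[z]).
Proof.
move=> a0 /andP[z0 z1]; have z1' : 0 < 1 - z by rewrite subr_gt0.
have a1 : 0 < 1 + a by rewrite ltr_pwDl.
rewrite /ferrers !ferrers_arg opprK [_ <= 0]leNgt a1 andbF.
have -> : hyp2F1 (- (a + q%:R)) (a + q%:R + 1) (1 + a) z =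
    (1 - z) `^ a * (jacobi_poly a q).[z].
  have B : 2 * a + q%:R + 1 - q%:R - (1 + a) = a by ring.
  have := @hyp2F1_euler R q (2 * a + q%:R + 1) (1 + a) z a1.
  rewrite B a0 (ltW z0) z1 => /(_ isT isT) <-.
  rewrite /hyp2F1; congr (limn (series _)); apply/funext => s.
  have -> : 1 + a + q%:R = a + q%:R + 1 by ring.
  have -> : 1 + a - (2 * a + q%:R + 1) = - (a + q%:R) by ring.
  by rewrite [X in X / _]mulrC.
have -> : (1 - z) `^ a = (1 - z) `^ (a / 2) * (1 - z) `^ (a / 2).
  by rewrite -powRD_gt0// -splitr.
rewrite powR_div// mulNr opprK powRM ?ltW// powRN.
by field; rewrite !gt_eqF ?powR_gt0 ?Gamma_gt0// lerDl.
Qed.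

Lemma pochhammer_natS m j : m`!%:R * pochhammer (1 + m%:R) j = (m + j)`!%:R :> R.
Proof.
elim: j => [|j IH]; first by rewrite pochhammer0 mulr1 addn0.
rewrite pochhammerS mulrA IH addnS factS natrM mulrC; congr (_ * _).
by rewrite -addrA -natrD nat1r.
Qed.

(** For integral [m], the regularized hypergeometric series starts at the
    power [z ^ m], the terms of lower order having a pole of [Gamma] in the
    denominator. *)
Lemma ferrers_nat m q z : (0 < m)%N -> 0 < z < 1 ->
  ferrers (m%:R + q%:R) m%:R (1 - 2 * z) =
  (-1) ^+ m * ((2 * m + q)`!%:R / (q`!%:R * m`!%:R)) *
  ((z * (1 - z)) `^ (m%:R / 2) * (jacobi_poly m%:R q).[z]).
Proof.
move=> m0 /andP[z0 z1]; have z1' : 0 < 1 - z by rewrite subr_gt0.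
have fact_neq0 i : i`!%:R != 0 :> R by rewrite pnatr_eq0 -lt0n fact_gt0.
rewrite /ferrers !ferrers_arg rpredB ?rpred1 ?rpred_nat//= subr_le0 ler1n m0.
have -> : hyp2F1_reg (- (m%:R + q%:R)) (m%:R + q%:R + 1) (1 - m%:R) z =
    (-1) ^+ m * ((2 * m + q)`!%:R / (q`!%:R * m`!%:R)) *
    (z ^+ m * (jacobi_poly m%:R q).[z]).
  rewrite /hyp2F1_reg (@limn_series_eventually0 _ _ (m + q.+1)%N); last first.
    move=> s ms; rewrite -natrD pochhammer_oppn_eq0 ?mul0r//.
    by rewrite -addnS.
  rewrite big_split_ord/= big1 ?add0r; last first.
    move=> i _; have -> : 1 - m%:R + i%:R = - (m - i.+1)%:R :> R.
      by rewrite natrB// -natr1; ring.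
    by rewrite Gamma_oppn mul0r invr0 mulr0 mul0r.
  rewrite horner_poly 2!mulr_sumr; apply: eq_bigr => j _.
  have -> : 1 - m%:R + (m + j)%:R = j.+1%:R :> R by rewrite natrD -natr1; ring.
  rewrite Gamma_natS !pochhammerD exprD -pochhammer_natS /gauss_coef.
  have -> : - (m%:R + q%:R) + m%:R = - q%:R :> R by ring.
  have -> : m%:R + q%:R + 1 + m%:R = 2 * m%:R + q%:R + 1 :> R by ring.
  rewrite -natrD pochhammer_oppn ?leq_addr//.
  have E1 : ((m + q) ^_ m)%:R = (m + q)`!%:R / q`!%:R :> R.
    by have := ffact_fact (leq_addr q m); rewrite addKn => <-; rewrite natrM mulfK.
  have E2 : pochhammer ((m + q)%:R + 1) m = (2 * m + q)`!%:R / (m + q)`!%:R :> R.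
    rewrite [_ + 1]addrC mul2n -addnn addnAC -pochhammer_natS.
    by rewrite [X in _ = X / _]mulrC mulfK.
  rewrite E1 E2; have pm : pochhammer (1 + m%:R) j != 0 :> R.
    by rewrite gt_eqF// pochhammer_gt0// ltr_pwDl.
  by field; rewrite !fact_neq0 pm.
rewrite powR_div// powRM ?ltW//.
have -> : z ^+ m = z `^ (m%:R / 2) * z `^ (m%:R / 2).
  by rewrite -powRD_gt0// -splitr powR_mulrn// ltW.
rewrite powRN; field.
by rewrite !fact_neq0 gt_eqF// powR_gt0.
Qed.

End FerrersValues.

(** * The weighted norm of the Jacobi polynomials *)

Section JacobiNorm.
Context {R : realType}.
Local Notation leb := (@lebesgue_measure R).
Variable a : R.
Hypothesis a0 : 0 <= a.
Implicit Types (p : {poly R}) (v : R) (i j m q : nat).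

(** The weight [z^a (1 - z)^a dz] transported to the half-line by
    [z = v / (1 + v)]. *)
Definition half_line_weight v : R := v `^ a * (1 + v) `^ (- (2 * a + 2)).

(** The product of the weight by a polynomial in [z]. *)
Definition weighted p v : R := half_line_weight v * p.[v / (1 + v)].

(** The moment functional of the weight on polynomials. *)
Definition moment p : R := Rintegral leb `]0, +oo[ (weighted p).

Lemma weighted_mono j m v : 0 < v ->
  weighted ('X^j * (1 - 'X) ^+ m) v =
  v `^ (a + 1 + j%:R - 1) * (1 + v) `^ (- (a + 1 + m%:R + (a + 1 + j%:R))).
Proof.
move=> v0; have v1 : 0 < 1 + v by rewrite addr_gt0.
have -> : a + 1 + j%:R - 1 = a + j%:R by ring.
have -> : - (a + 1 + m%:R + (a + 1 + j%:R)) = - (2 * a + 2) - j%:R - m%:R by ring.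
rewrite /weighted /half_line_weight hornerM hornerXn horner_exp.
rewrite hornerD hornerN hornerX hornerC.
have -> : 1 - v / (1 + v) = (1 + v)^-1 by field; rewrite gt_eqF.
rewrite !powRD_gt0// !powRN !powR_mulrn ?ltW// exprMn !exprVn.
by ring.
Qed.

Lemma integral_weighted_mono j m :
  (\int[leb]_(v in `]0%R, +oo[) (weighted ('X^j * (1 - 'X) ^+ m) v)%:E =
   (Gamma (a + 1 + m%:R) * Gamma (a + 1 + j%:R) /
    Gamma (a + 1 + m%:R + (a + 1 + j%:R)))%:E)%E.
Proof.
have ge1 i : 1 <= a + 1 + i%:R by rewrite addrAC lerDr addr_ge0.
rewrite -beta_intE//; apply: eq_integral => v.
by rewrite inE/= in_itv/= andbT => v0; rewrite weighted_mono.
Qed.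

Lemma weighted_sum p v : weighted p v = \sum_(i < size p) p`_i * weighted 'X^i v.
Proof.
rewrite /weighted horner_coef mulr_sumr; apply: eq_bigr => i _.
by rewrite hornerXn mulrCA.
Qed.

Lemma measurable_weightedXn i : measurable_fun `](0 : R), +oo[ (weighted 'X^i).
Proof.
apply: (@eq_measurable_fun _ _ _ _ _ (fun v => v `^ (a + 1 + i%:R - 1) *
  (1 + v) `^ (- (a + 1 + 0%:R + (a + 1 + i%:R))))).
  move=> v; rewrite inE/= in_itv/= andbT => v0.
  by rewrite -weighted_mono// expr0 mulr1.
apply: measurable_funTS; apply: measurable_funM; first exact: measurable_powR.
by apply: (measurableT_comp (measurable_powR _)); exact: measurable_funD.
Qed.

Lemma integrable_weightedXn i : leb.-integrable `](0 : R), +oo[ (EFin \o weighted 'X^i).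
Proof.
apply/integrableP; split; first by apply/measurable_EFinP; exact: measurable_weightedXn.
have := integral_weighted_mono i 0; rewrite expr0 mulr1 => E.
suff -> : (\int[leb]_(x in `]0%R, +oo[) `|(EFin \o weighted 'X^i) x| =
    \int[leb]_(v in `]0%R, +oo[) (weighted 'X^i v)%:E)%E by rewrite E ltry.
apply: eq_integral => v; rewrite inE/= in_itv/= andbT => v0.
rewrite ger0_norm// /weighted /half_line_weight hornerXn.
by rewrite !mulr_ge0 ?powR_ge0 ?exprn_ge0// divr_ge0// ?addr_ge0// ltW.
Qed.

Lemma integrable_weighted p : leb.-integrable `](0 : R), +oo[ (EFin \o weighted p).
Proof.
rewrite (_ : _ \o _ = (fun v =>
  \sum_(i < size p) (p`_i)%:E * (weighted 'X^i v)%:E)%E); last first.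
  by apply/funext => v; rewrite /= weighted_sum sumEFin.
apply: integrable_sum => // i _; apply: integrableZl => //.
exact: integrable_weightedXn.
Qed.

Lemma integral_weighted p :
  (\int[leb]_(v in `]0%R, +oo[) (weighted p v)%:E = (moment p)%:E)%E.
Proof.
rewrite /moment /Rintegral fineK//.
exact: integrable_fin_num (integrable_weighted p).
Qed.

Lemma momentD p1 p2 : moment (p1 + p2) = moment p1 + moment p2.
Proof.
rewrite /moment -RintegralD//; [|exact: integrable_weighted..].
by apply: eq_Rintegral => v _; rewrite /weighted hornerD mulrDr.
Qed.

Lemma momentZ c p : moment (c *: p) = c * moment p.
Proof.
rewrite /moment -RintegralZl//; last exact: integrable_weighted.
by apply: eq_Rintegral => v _; rewrite /weighted hornerZ mulrCA.
Qed.

Lemma moment0 : moment 0 = 0.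
Proof. by rewrite -(scale0r 0) momentZ mul0r. Qed.

Lemma moment_sum n (P : 'I_n -> {poly R}) :
  moment (\sum_(i < n) P i) = \sum_(i < n) moment (P i).
Proof. by rewrite (big_morph moment momentD moment0). Qed.

Lemma moment_mono j m : moment ('X^j * (1 - 'X) ^+ m) =
  Gamma (a + 1) ^+ 2 / Gamma (2 * a + 2) *
  (pochhammer (a + 1) m * pochhammer (a + 1) j / pochhammer (2 * a + 2) (m + j)).
Proof.
apply: EFin_inj; rewrite -integral_weighted integral_weighted_mono; congr EFin.
have a1 : 1 <= a + 1 by rewrite lerDr.
have a2 : 1 <= 2 * a + 2.
  by rewrite -[leLHS]add0r lerD ?mulr_ge0// ler1n.
have -> : a + 1 + m%:R + (a + 1 + j%:R) = 2 * a + 2 + (m + j)%:R.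
  by rewrite natrD; ring.
rewrite (Gamma_pochhammer m a1) (Gamma_pochhammer j a1) (Gamma_pochhammer (m + j) a2).
by rewrite !invfM; ring.
Qed.

Let jac q := jacobi_poly a q.

Lemma jacobi_polyE q : jac q =
  \sum_(j < q.+1) gauss_coef (- q%:R) (2 * a + q%:R + 1) (1 + a) j *: 'X^j.
Proof. by rewrite /jac /jacobi_poly /gauss_poly poly_def. Qed.

(** The powers of [1 - 'X] are better test functions than those of ['X]: their
    moments against [jac q] are Chu-Vandermonde sums. *)
Lemma moment_jacobi_mono q m : moment (jac q * (1 - 'X) ^+ m) =
  Gamma (a + 1) ^+ 2 / Gamma (2 * a + 2) *
  (pochhammer (a + 1) m / pochhammer (2 * a + 2) m *
  (pochhammer (m%:R + 1 - q%:R) q / pochhammer (2 * a + 2 + m%:R) q)).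
Proof.
have c0 : 0 < 2 * a + 2 + m%:R.
  by rewrite -addrA ltr_wpDl ?mulr_ge0// ltr_pwDl.
have d0 : 0 < 1 + a by rewrite ltr_pwDl.
have := @chu_vandermonde R q (2 * a + q%:R + 1) (2 * a + 2 + m%:R) (1 + a) c0 d0.
have -> : 2 * a + 2 + m%:R - (2 * a + q%:R + 1) = m%:R + 1 - q%:R by ring.
move=> <-; rewrite jacobi_polyE mulr_suml moment_sum !mulr_sumr.
apply: eq_bigr => j _; rewrite -scalerAl momentZ moment_mono pochhammerD.
by rewrite !invfM [1 + a]addrC; ring.
Qed.

Lemma moment_jacobi_orth q m : (m < q)%N -> moment (jac q * (1 - 'X) ^+ m) = 0.
Proof.
move=> mq; rewrite moment_jacobi_mono.
have -> : m%:R + 1 - q%:R = - (q - m.+1)%:R :> R by rewrite natrB// -natr1; ring.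
rewrite pochhammer_oppn_eq0 ?mul0r ?mulr0//.
by rewrite ltn_subLR// addSn ltnS leq_addl.
Qed.

(** When one factor [jac q] is expanded in powers of [1 - 'X], only the top power
    contributes, by orthogonality. *)
Lemma moment_jacobi_sqr q : moment (jac q * jac q) =
  Gamma (1 + a) ^+ 2 * q`!%:R / ((2 * q%:R + 2 * a + 1) * Gamma (2 * a + q%:R + 1)).
Proof.
have expand : jac q * jac q = \sum_(j < q.+1) \sum_(m < j.+1)
    (gauss_coef (- q%:R) (2 * a + q%:R + 1) (1 + a) j * ((-1) ^+ m *+ 'C(j, m))) *:
    (jac q * (1 - 'X) ^+ m).
  rewrite {2}jacobi_polyE mulr_sumr; apply: eq_bigr => j _.
  have -> : 'X^j = (1 - (1 - 'X)) ^+ j :> {poly R} by rewrite opprB addrC subrK.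
  rewrite exprBn scaler_sumr mulr_sumr; apply: eq_bigr => m _.
  rewrite expr1n mulr1 -scalerAr -scalerA; congr (_ *: _).
  rewrite -scalerMnl mulrnAr; congr (_ *+ _).
  by rewrite mulrCA -mul_polyC polyC_exp polyCN.
rewrite expand moment_sum big_ord_recr/= big1 ?add0r; last first.
  move=> j _; rewrite moment_sum big1// => m _; rewrite momentZ.
  by rewrite moment_jacobi_orth ?mulr0//; apply: leq_trans (ltn_ord m) _.
rewrite moment_sum big_ord_recr/= big1 ?add0r; last first.
  by move=> m _; rewrite momentZ moment_jacobi_orth ?mulr0.
rewrite momentZ binn mulr1n moment_jacobi_mono /gauss_coef.
have -> : q%:R + 1 - q%:R = 1 :> R by ring.
have := @pochhammer_natS R 0 q; rewrite fact0 mul1r addr0 add0n => ->.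
rewrite pochhammer_oppn// ffactnn.
have a2 : 1 <= 2 * a + 2.
  by rewrite -[leLHS]add0r lerD ?mulr_ge0// ler1n.
have aq : 1 <= 2 * a + q%:R + 1 by rewrite lerDr addr_ge0// mulr_ge0.
(* both sides are Gamma (2 * a + 2 * q + 2) *)
have G1 : Gamma (2 * a + 2) *
      (pochhammer (2 * a + 2) q * pochhammer (2 * a + 2 + q%:R) q) =
    (2 * q%:R + 2 * a + 1) *
      (Gamma (2 * a + q%:R + 1) * pochhammer (2 * a + q%:R + 1) q).
  rewrite -pochhammerD -(Gamma_pochhammer _ a2) -(Gamma_pochhammer _ aq).
  have -> : 2 * a + 2 + (q + q)%:R = 2 * q%:R + 2 * a + 1 + 1 by rewrite natrD; ring.
  rewrite GammaS; last by rewrite lerDr addr_ge0 ?mulr_ge0.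
  by congr (_ * Gamma _); ring.
have pd : 0 < pochhammer (1 + a) q by rewrite pochhammer_gt0// ltr_pwDl.
have p1 : 0 < pochhammer (2 * a + 2) q.
  by rewrite pochhammer_gt0// (lt_le_trans _ a2).
have p2 : 0 < pochhammer (2 * a + 2 + q%:R) q.
  by rewrite pochhammer_gt0// ltr_wpDr// (lt_le_trans _ a2).
have p3 : 0 < pochhammer (2 * a + q%:R + 1) q.
  by rewrite pochhammer_gt0// (lt_le_trans _ aq).
have g1 := Gamma_gt0 a2; have g2 := Gamma_gt0 aq.
have l0 : 0 < 2 * q%:R + 2 * a + 1 by rewrite ltr_wpDl// addr_ge0 ?mulr_ge0.
have f0 : q`!%:R != 0 :> R by rewrite pnatr_eq0 -lt0n fact_gt0.
have sq : (-1) ^+ q * (-1) ^+ q = 1 :> R by rewrite -exprMn mulrNN mulr1 expr1n.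
rewrite [a + 1]addrC.
transitivity ((-1) ^+ q * (-1) ^+ q * Gamma (1 + a) ^+ 2 * q`!%:R *
    pochhammer (2 * a + q%:R + 1) q /
  (Gamma (2 * a + 2) *
    (pochhammer (2 * a + 2) q * pochhammer (2 * a + 2 + q%:R) q))).
  by field; rewrite f0 !gt_eqF.
by rewrite G1 sq; field; rewrite !gt_eqF.
Qed.

End JacobiNorm.

(** * Integration against a density *)

Section IntegralDensity.
Local Open Scope ereal_scope.
Context d (T : measurableType d) (R : realType).
Variables (mu nu : {measure set T -> \bar R}) (g : T -> R).
Hypotheses (mg : measurable_fun setT g) (g0 : forall x, (0 <= g x)%R).
Hypothesis nuE : forall A, measurable A -> nu A = \int[mu]_(x in A) (g x)%:E.

Let integral_density_indic E : measurable E ->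
  \int[nu]_x (\1_E x)%:E = \int[mu]_x ((\1_E x)%:E * (g x)%:E).
Proof.
move=> mE; rewrite integral_indic// setIT nuE// integral_mkcond.
by apply: eq_integral => x _; rewrite epatch_indic muleC.
Qed.

Import HBNNSimple.

Let integral_density_nnsfun (f : {nnsfun T >-> R}) :
  \int[nu]_x (f x)%:E = \int[mu]_x ((f x)%:E * (g x)%:E).
Proof.
have mEg : measurable_fun setT (EFin \o g) by exact/measurable_EFinP.
under [LHS]eq_integral do rewrite fimfunE -fsumEFin//.
rewrite [LHS]ge0_integral_fsum//; last 2 first.
  - by move=> r; exact/measurable_EFinP/measurableT_comp.
  - by move=> n x _; rewrite EFinM nnfun_muleindic_ge0.
under [RHS]eq_integral.
  move=> x xD; rewrite fimfunE -fsumEFin// muleC ge0_mule_fsumr; last first.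
    by move=> r; rewrite EFinM nnfun_muleindic_ge0.
  over.
rewrite [RHS]ge0_integral_fsum//; last 2 first.
  - move=> r; apply: emeasurable_funM => //.
    by apply/measurable_EFinP; apply/measurableT_comp => //.
  - move=> n x _; rewrite mule_ge0//; first by rewrite lee_fin.
    by rewrite EFinM nnfun_muleindic_ge0.
apply: eq_fsbigr => r _.
have [r0|r0] := leP 0%R r; last first.
  rewrite !integral0_eq// => x _; rewrite preimage_nnfun0// indicE in_set0.
    by rewrite mulr0 mule0.
  by rewrite mulr0.
under [RHS]eq_integral do rewrite EFinM muleCA [(g _)%:E * _]muleC.
under [LHS]eq_integral do rewrite EFinM.
rewrite ge0_integralZl_EFin//; last exact/measurable_EFinP/measurable_indic.
rewrite ge0_integralZl_EFin//; last 2 first.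
- by move=> x _; rewrite mule_ge0// lee_fin.
- apply: emeasurable_funM => //; exact/measurable_EFinP/measurable_indic.
by rewrite integral_density_indic.
Qed.

(** Integration against a measure given by a density; the proof is by monotone
    approximation by simple functions. *)
Lemma ge0_integral_density (f : T -> \bar R) :
  measurable_fun setT f -> (forall x, 0 <= f x) ->
  \int[nu]_x f x = \int[mu]_x (f x * (g x)%:E).
Proof.
move=> mf f0.
have mEg : measurable_fun setT (EFin \o g) by exact/measurable_EFinP.
pose f_ := nnsfun_approx measurableT mf.
transitivity (limn (fun n => \int[nu]_x (f_ n x)%:E)).
  rewrite -monotone_convergence//=.
  - apply: eq_integral => ? /[!inE] xD; apply/esym/cvg_lim => //=.
    exact: cvg_nnsfun_approx.
  - by move=> n; exact/measurable_EFinP/measurable_funTS.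
  - by move=> n ? _; rewrite lee_fin.
  - by move=> ? _ ? ? mn; rewrite lee_fin; exact/lefP/nd_nnsfun_approx.
transitivity (limn (fun n => \int[mu]_x ((f_ n x)%:E * (g x)%:E))).
  by congr (limn _); apply/funext => n; exact: integral_density_nnsfun.
rewrite -monotone_convergence//=.
- apply: eq_integral => x _; apply/cvg_lim => //=.
  apply: cvgeZr => //; exact: cvg_nnsfun_approx.
- move=> n; apply: emeasurable_funM => //.
  exact/measurable_EFinP/measurable_funTS.
- by move=> n x _; rewrite mule_ge0// lee_fin.
- move=> x _ i j ij; rewrite lee_wpmul2r ?lee_fin//.
  exact/lefP/nd_nnsfun_approx.
Qed.

End IntegralDensity.

(** * Radial integrals for the area measure *)

Section RadialIntegral.
Context {R : realType} (n : nat).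
Hypothesis n0 : (0 < n)%N.
Local Notation leb := (@lebesgue_measure R).
Local Notation RxR := (measurableTypeR R * measurableTypeR R)%type.

Let n20 : (0 < 2 * n)%N. Proof. by rewrite muln_gt0. Qed.

Lemma exprn_mul2_ge0 (r : R) : 0 <= r ^+ (2 * n).
Proof. by rewrite exprM exprn_ge0// sqr_ge0. Qed.

Let w (p : R * R) : R := (@area_density R n \_ polar_domain) p.

Let w_ge0 p : 0 <= w p.
Proof.
rewrite /w patchE; case: ifPn => // /set_mem[/= + _].
rewrite in_itv/= andbT => r0; rewrite /area_density divr_ge0//.
- by rewrite !mulr_ge0// exprn_ge0// ltW.
- by rewrite sqr_ge0.
Qed.

Let measurable_polar_domain : measurable (polar_domain : set RxR).
Proof. by apply: measurableX; exact: measurable_itv. Qed.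

Let measurable_w : measurable_fun [set: RxR] w.
Proof.
apply/(measurable_restrictT _ measurable_polar_domain)/measurable_funTS.
rewrite /area_density; apply: measurable_funM.
  apply: measurable_funM; first exact: measurable_cst.
  by apply: measurable_funX; exact: measurable_fst.
pose k (x : R) : R := ((1 + x ^+ (2 * n)) ^+ 2)^-1.
have mk : measurable_fun [set: R] k.
  apply: continuous_measurable_fun => x; apply: cvgV.
    by rewrite expf_neq0// gt_eqF// ltr_wpDr// exprn_mul2_ge0.
  apply: cvgM; apply: cvgD; [exact: cvg_cst|exact: exprn_continuous
                            |exact: cvg_cst|exact: exprn_continuous].
exact: (measurableT_comp mk measurable_fst).
Qed.

(** Integral over [X'] of a function of [|x|^(2n)] alone.  The value of the
    integrand at the origin, which is not a point of [X'], is irrelevant. *)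
Lemma integral_dA_radial (h G : R -> R) :
  (forall r, 0 <= h r) -> (forall r, r != 0 -> h r = G (r ^+ (2 * n))) ->
  (forall v, 0 <= v -> 0 <= G v) -> continuous (fun v : R => G `|v|) ->
  (\int[dA n]_p (h p.1)%:E =
   (4 * pi * n%:R)%:E * \int[leb]_(v in `]0%R, +oo[) (G v / (1 + v) ^+ 2)%:E)%E.
Proof.
move=> h0 hG G0 cG.
pose H (v : R) : R := G v / (1 + v) ^+ 2.
have H0 v : 0 <= v -> 0 <= H v by move=> v0; rewrite divr_ge0 ?G0// sqr_ge0.
have cH : continuous (fun v : R => H `|v|).
  move=> v; apply: cvgM; first exact: cG.
  have nv : `|x| @[x --> v] --> `|v| by exact: norm_continuous.
  apply: cvgV; first by rewrite expf_neq0// gt_eqF// ltr_pwDl.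
  by apply: cvgM; apply: cvgD => //; exact: cvg_cst.
have mH := continuous_measurable_fun cH.
have mh : measurable_fun [set: R] h.
  have -> : h = (fun r => if r == 0 then h 0 else G `|r ^+ (2 * n)|).
    apply/funext => r; case: eqP => [->//|/eqP r0].
    by rewrite hG// ger0_norm// exprn_mul2_ge0.
  apply: measurable_fun_ifT => //; first exact: measurable_fun_eqr.
  apply: (measurableT_comp (continuous_measurable_fun cG)).
  exact: measurable_funX.
(* the absolute value makes f measurable on the whole plane *)
pose f (p : R * R) : R :=
  H `|p.1 ^+ (2 * n)| * (4 * n%:R ^+ 2 * p.1 ^+ (2 * n - 1)).
have mf : measurable_fun [set: RxR] (EFin \o f).
  apply/measurable_EFinP; apply: measurable_funM.
    apply: (measurableT_comp mH); apply: measurable_funX; exact: measurable_fst.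
  by apply: measurable_funM => //; apply: measurable_funX; exact: measurable_fst.
have f0 p : (`]0, +oo[ `*` `[0, 2 * pi[)%classic p -> (0 <= (EFin \o f) p)%E.
  case; rewrite /= in_itv/= andbT => p0 _; rewrite lee_fin.
  by rewrite mulr_ge0 ?H0// mulr_ge0 ?mulr_ge0 ?exprn_ge0// ltW.
rewrite (@ge0_integral_density _ _ _ (leb \x leb)%E (dA n) w)//; last 2 first.
- apply/measurable_EFinP; exact: (measurableT_comp mh measurable_fst).
- by move=> p; rewrite lee_fin.
transitivity (\int[leb \x leb]_(p in `]0%R, +oo[ `*` `[0%R, (2 * pi)%R[)
    (EFin \o f) p)%E.
  rewrite [RHS]integral_mkcond; apply: eq_integral => -[r t] _.
  rewrite /w !patchE /polar_domain -EFinM; case: ifPn => [|_]; last by rewrite mulr0.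
  move=> /set_mem[/= + _]; rewrite in_itv/= andbT => r0; congr EFin.
  rewrite hG ?gt_eqF// /area_density /f /H/= ger0_norm ?exprn_mul2_ge0//.
  by rewrite -[RHS]mulrA [_^-1 * _]mulrC.
rewrite (tonelli_setX1 leb leb _ _ mf f0)//.
transitivity (\int[leb]_(r in `]0%R, +oo[) ((4 * pi * n%:R)%:E *
   (H (1 * r ^+ (2 * n)) * (1 * (2 * n)%:R * r ^+ (2 * n).-1))%:E))%E.
  apply: eq_integral => r; rewrite inE/= in_itv/= andbT => r0.
  rewrite (_ : (fun y => _) = cst (f (r, 0))%:E) ?integral_cst//.
  rewrite /= lebesgue_measure_itv/= lte_fin mulr_gt0 ?pi_gt0//.
  rewrite -EFinB subr0 -!EFinM /f/= ger0_norm ?exprn_mul2_ge0// subn1 natrM.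
  by congr EFin; rewrite (mul1r (r ^+ (2 * n))); ring.
rewrite ge0_integralZl_EFin//; last 3 first.
- move=> r; rewrite /= in_itv/= andbT => r0; rewrite lee_fin mulr_ge0//.
    by rewrite H0// mul1r exprn_mul2_ge0.
  by rewrite mulr_ge0 ?exprn_ge0// ltW.
- apply/measurable_EFinP/measurable_funTS; apply: measurable_funM; last first.
    by apply: measurable_funM => //; exact: measurable_funX.
  rewrite (_ : (fun _ => _) = (fun r : R => H `|r ^+ (2 * n)|)); last first.
    by apply/funext => r; rewrite mul1r ger0_norm// exprn_mul2_ge0.
  by apply: (measurableT_comp mH); exact: measurable_funX.
- by rewrite !mulr_ge0// pi_ge0.
by rewrite -ge0_integral_monomial_subst.
Qed.

End RadialIntegral.

Lemma continuous_weighted_normr {R : realType} (a : R) (p : {poly R}) : 0 <= a ->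
  continuous (fun v : R => weighted a p `|v|).
Proof.
move=> a0 v; have nv : `|x| @[x --> v] --> `|v| by exact: norm_continuous.
have v1 : 0 < 1 + `|v| by rewrite ltr_pwDl.
have c1 : 1 + `|x| @[x --> v] --> 1 + `|v| by apply: cvgD => //; exact: cvg_cst.
apply: cvgM.
  apply: cvgM; first exact: continuous_normr_powR.
  apply: (@continuous_comp _ _ _ (fun x : R => 1 + `|x|)
    (fun y : R => y `^ (- (2 * a + 2)))) => //.
  apply/differentiable_continuous/derivable1_diffP/derivable_powR.
  by rewrite in_itv/= andbT.
apply: (@continuous_comp _ _ _ (fun x : R => `|x| / (1 + `|x|)) (horner p)).
  by apply: cvgM => //; apply: cvgV => //; rewrite gt_eqF.
exact: continuous_horner.
Qed.

(** * The norm of [Psi] *)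

Section NormPsi.
Context {R : realType}.
Local Notation leb := (@lebesgue_measure R).

(** The radial factor of [Psi]. *)
Definition radial_factor (n q : nat) (k : int) : R -> R :=
  if k == 0 then legendre q else ferrers (alpha n k + q%:R) (mu n k).

Lemma alpha_ge0 (n : nat) (k : int) : 0 <= alpha n k :> R.
Proof. by rewrite /alpha divr_ge0// ler0z. Qed.

Lemma normc_Psi n q k (p : R * R) :
  ComplexField.Normc.normc (Psi n q k p) =
  `|radial_factor n q k ((1 - p.1 ^+ (2 * n)) / (1 + p.1 ^+ (2 * n)))|.
Proof.
have nr (x : R) : ComplexField.Normc.normc (x%:C)%C = `|x|.
  by rewrite /ComplexField.Normc.normc/= expr0n/= addr0 sqrtr_sqr.
rewrite /Psi /radial_factor; case: ifPn => _; first by rewrite nr.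
rewrite ComplexField.Normc.normcM nr /expi /ComplexField.Normc.normc.
by rewrite cos2Dsin2 sqrtr1 mulr1.
Qed.

(** Whether [k] is zero, or [alpha n k] is a positive integer, or it is not an
    integer, the radial factor is a multiple of
    [(z (1 - z)) `^ (alpha n k / 2) * (jacobi_poly (alpha n k) q).[z]]; only the
    square of the constant depends on the case. *)
Lemma radial_factorE n q k : (0 < n)%N -> exists K : R,
  (forall z, 0 < z < 1 -> radial_factor n q k (1 - 2 * z) =
     K * ((z * (1 - z)) `^ (alpha n k / 2) * (jacobi_poly (alpha n k) q).[z])) /\
  K ^+ 2 * (Gamma (1 + alpha n k) ^+ 2 * q`!%:R / Gamma (2 * alpha n k + q%:R + 1)) =
  if k == 0 then 1 else Gamma (alpha n k + q%:R + mu n k + 1) /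
                        Gamma (alpha n k + q%:R - mu n k + 1).
Proof.
move=> n0; have a0 := alpha_ge0 n k.
have G1 := Gamma_gt0 (_ : 1 <= 1 + alpha n k :> R).
have G2 := Gamma_gt0 (_ : 1 <= 2 * alpha n k + q%:R + 1 :> R).
have {}G1 : 0 < Gamma (1 + alpha n k) :> R by rewrite G1// lerDl.
have {}G2 : 0 < Gamma (2 * alpha n k + q%:R + 1) :> R.
  by rewrite G2// lerDr addr_ge0 ?mulr_ge0.
have fact_neq0 i : i`!%:R != 0 :> R by rewrite pnatr_eq0 -lt0n fact_gt0.
have Gq : Gamma (q%:R + 1) = q`!%:R :> R by rewrite natr1 Gamma_natS.
have [k0|k0] := eqVneq k 0.
  have a_0 : alpha n k = 0 :> R by rewrite /alpha k0 normr0 mul0r.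
  exists (Gamma (1 + alpha n k))^-1; split => [z z01|].
    by rewrite -ferrers_oppr// /radial_factor k0 eqxx -k0 a_0 /legendre add0r oppr0.
  rewrite a_0 mulr0 add0r Gq; field.
  by rewrite fact_neq0 gt_eqF// Gamma_gt0// addr0.
have [aint|aint] := boolP ((alpha n k : R) \is a Num.int); last first.
  have muE : mu n k = - alpha n k :> R by rewrite /mu (negbTE aint).
  exists (Gamma (1 + alpha n k))^-1; split => [z z01|].
    by rewrite -ferrers_oppr// /radial_factor (negbTE k0) muE.
  have -> : alpha n k + q%:R + mu n k + 1 = q%:R + 1 :> R by rewrite muE; ring.
  have -> : alpha n k + q%:R - mu n k + 1 = 2 * alpha n k + q%:R + 1 :> R.
    by rewrite muE; ring.
  by rewrite Gq; field; rewrite !gt_eqF.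
have muE : mu n k = alpha n k :> R by rewrite /mu aint.
have [m mE] : exists m : nat, alpha n k = m%:R :> R.
  have : (alpha n k : R) \is a Num.nat by rewrite natrEint aint a0.
  by move=> /natrP.
have m0 : (0 < m)%N.
  rewrite lt0n -(pnatr_eq0 R) -mE /alpha mulf_neq0 ?invr_eq0 ?pnatr_eq0 -?lt0n//.
  by rewrite absz_gt0.
exists ((-1) ^+ m * ((2 * m + q)`!%:R / (q`!%:R * m`!%:R))); split => [z z01|].
  by rewrite /radial_factor (negbTE k0) muE mE ferrers_nat.
have -> : alpha n k + q%:R + mu n k + 1 = (2 * m + q)%:R + 1 :> R.
  by rewrite muE mE natrD natrM; ring.
have -> : alpha n k + q%:R - mu n k + 1 = q%:R + 1 :> R by rewrite muE mE; ring.
have -> : 2 * alpha n k + q%:R + 1 = (2 * m + q)%:R + 1 :> R.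
  by rewrite mE natrD natrM.
rewrite Gq mE -[1 + m%:R]addrC !natr1 !Gamma_natS.
rewrite exprMn -exprM mulnC exprM sqrrN expr1n expr1n mul1r.
by field; rewrite !fact_neq0.
Qed.

Lemma L2norm_sqr (n : nat) (f : R * R -> R[i]) (c : R) :
  (\int[dA n]_p ((ComplexField.Normc.normc (f p)) ^+ 2)%:E = c%:E)%E ->
  (L2norm n f ^+ 2)%E = c%:E.
Proof.
move=> fc; have c0 : 0 <= c.
  by rewrite -lee_fin -fc; apply: integral_ge0 => p _; rewrite lee_fin sqr_ge0.
rewrite /L2norm unlock /Lnorm.
have -> : (\int[dA n]_p (`|(ComplexField.Normc.normc (f p))%:E| `^ 2) = c%:E)%E.
  rewrite -fc; apply: eq_integral => p _.
  by rewrite /= powR_mulrn// real_normK ?num_real.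
by rewrite poweR_EFin -EFin_expe -powR_mulrn ?powR_ge0// -powRrM mulVf// powRr1.
Qed.

End NormPsi.

Theorem lemma3p4 (R : realType) (n : nat) (hn : (2 <= n)%N)
    (q : nat) (k : int) :
  (L2norm n (@Psi R n q k) ^+ 2)%E =
  (if k == 0 then 4 * pi * n%:R / (2 * q%:R + 1)
   else 4 * pi * n%:R / (2 * q%:R + 2 * alpha n k + 1) *
        (Gamma (alpha n k + q%:R + mu n k + 1) /
         Gamma (alpha n k + q%:R - mu n k + 1)))%:E.
Proof.
have n0 : (0 < n)%N by exact: leq_trans hn.
have [K [PE KE]] := @radial_factorE R n q k n0.
have a0 := @alpha_ge0 R n k.
move: KE PE; set a := alpha n k => KE PE; set F := jacobi_poly a q.
apply: L2norm_sqr.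
pose P := radial_factor n q k : R -> R.
pose h (r : R) : R := P ((1 - r ^+ (2 * n)) / (1 + r ^+ (2 * n))) ^+ 2.
(* G expresses the squared radial factor in the variable v = r ^ (2 n), for which
   z = v / (1 + v). *)
pose G (v : R) : R := K ^+ 2 * weighted a (F * F) v * (1 + v) ^+ 2.
have w0 v : 0 <= weighted a (F * F) v.
  rewrite /weighted hornerM; apply: mulr_ge0; last by rewrite -expr2 sqr_ge0.
  by rewrite mulr_ge0 ?powR_ge0.
transitivity (\int[dA n]_p (h p.1)%:E)%E.
  by apply: eq_integral => p _; rewrite normc_Psi real_normK ?num_real.
rewrite (integral_dA_radial n0 (h := h) (G := G)); last 4 first.
- by move=> r; exact: sqr_ge0.
- move=> r r0; rewrite /h /G.
  have : 0 < r ^+ (2 * n) by rewrite lt_neqAle eq_sym expf_neq0//= exprn_mul2_ge0.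
  move: (r ^+ (2 * n)) => v v0.
  have v1 : 0 < 1 + v by rewrite addr_gt0.
  have z01 : 0 < v / (1 + v) < 1.
    by rewrite divr_gt0//= ltr_pdivrMr// mul1r ltrDr.
  have -> : (1 - v) / (1 + v) = 1 - 2 * (v / (1 + v)) by field; rewrite gt_eqF.
  rewrite /P PE// -/F /weighted hornerM /half_line_weight.
  have -> : v / (1 + v) * (1 - v / (1 + v)) = v / (1 + v) ^+ 2 by field; rewrite gt_eqF.
  have E : ((v / (1 + v) ^+ 2) `^ (a / 2)) ^+ 2 = v `^ a * (1 + v) `^ (2 * - a).
    rewrite -powR_mulrn ?powR_ge0// -powRrM divfK// powR_div ?exprn_gt0//.
    by rewrite -[(1 + v) ^+ 2](powR_mulrn 2) ?ltW// -powRrM.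
  rewrite 2!exprMn E; have -> : - (2 * a + 2) = 2 * - a - 2 by ring.
  rewrite (powRD_gt0 _ _ v1) (powRN _ 2) (powR_mulrn 2) ?ltW//.
  by field; rewrite gt_eqF.
- move=> v _; apply: mulr_ge0; last exact: sqr_ge0.
  by apply: mulr_ge0 => //; exact: sqr_ge0.
- move=> v; have nv : `|x| @[x --> v] --> `|v| by exact: norm_continuous.
  apply: cvgM; last by apply: cvgM; apply: cvgD => //; exact: cvg_cst.
  by apply: cvgMr; exact: continuous_weighted_normr.
have -> : (\int[@lebesgue_measure R]_(v in `]0%R, +oo[)
      (G v / (1 + v) ^+ 2)%:E =
    (K ^+ 2 * moment a (F * F))%:E)%E.
  rewrite EFinM -integral_weighted// -ge0_integralZl_EFin ?sqr_ge0//; last 2 first.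
  - by move=> v _; rewrite lee_fin.
  - exact: measurable_int (integrable_weighted a0 (F * F)).
  apply: eq_integral => v; rewrite inE/= in_itv/= andbT => v0.
  by rewrite -EFinM /G mulfK// expf_neq0// gt_eqF// addr_gt0.
rewrite -EFinM moment_jacobi_sqr//; congr EFin.
have E : K ^+ 2 * (Gamma (1 + a) ^+ 2 * q`!%:R /
     ((2 * q%:R + 2 * a + 1) * Gamma (2 * a + q%:R + 1))) =
   (if k == 0 then 1 else
      Gamma (a + q%:R + mu n k + 1) / Gamma (a + q%:R - mu n k + 1)) /
   (2 * q%:R + 2 * a + 1).
  by rewrite -KE invfM; ring.
rewrite E; case: ifPn => [/eqP k0|_]; last by rewrite mulrCA mulrC mulrA -mulrA.
have -> : a = 0 by rewrite /a /alpha k0 normr0 mul0r.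
by rewrite mulr0 addr0 mul1r.
Qed.
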